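(* Let $(c_1,\mathcal{I}_1)$ and $(c_2,\mathcal{I}_2)$ be two Erlangen circles. Given a point $A$ of $c_1$ and a point $B$ of $c_2$, there is an isometry $f:c_1\to c_2$ such that $f(A)=B$.
   Context: A betweenness relation on a set $\Pi$ is a ternary relation ''$C$ is between $A$ and $B$'' such that, writing $s[A,B]$ for the set of all points between $A$ and $B$: (a) each point is between itself and any point of $\Pi$; (b) if $A$ is between $B$ and $C$, then $A$ is between $C$ and $B$; (c) if $C\in s[A,B]$, then $s[A,B]=s[A,C]\cup s[C,B]$ and $s[A,C]\cap s[C,B]=s[C,C]=\{C\}$. A closed line segment is a set of the form $s[A,B]$. A subset $S$ is convex if $s[A,B]\subset S$ for all $A,B\in S$. A closed line segment is connected if, whenever it is expressed as a union of two disjoint non-empty convex subsets, precisely one of them is a closed line segment. An isomorphism of sets with betweenness is a bijection with $f(s[A,B])=s[f(A),f(B)]$ for all $A,B$. A line is a set $l$ with betweenness, consisting of at least two points, such that for every $A\in l$ the complement $l\setminus\{A\}$ is the union of two disjoint non-empty convex sets $c_1,c_2$ with $A\in s[B,C]$ whenever $B\in c_1$, $C\in c_2$. A circle is a set $c$ with betweenness such that: $c$ contains at least three points; each $A\in c$ has an antipodal point $a(A)$ such that $s[A,a(A)]$ contains exactly two points; $s[A,B]$ is connected if $A$ is not antipodal to $B$; for each $A\in c$ the complement $c\setminus\{A,a(A)\}$ is the union of two disjoint non-empty convex sets $l_1,l_2$ that are lines with the inherited betweenness. The maximal rays of $c$ emanating from $A$ are the two sets $\{A\}\cup l_1$, $\{A\}\cup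 l_2$. An Erlangen circle is a pair $(c,\mathcal{I})$ of a circle $c$ and a subgroup $\mathcal{I}$ of the group of isomorphisms of $c$ such that for every ordered pair of maximal rays in $c$ there is exactly one element of $\mathcal{I}$ sending the first ray onto the second. For $A\in c$, the reflection $i_A$ is the element of $\mathcal{I}$ that switches the two maximal rays emanating from $A$; a point $B$ forms a right angle with $A$ if $i_A(B)=a(B)$. Segments $s[A,B]$, $s[C,D]$ are congruent if some $\tau\in\mathcal{I}$ satisfies $\tau(s[A,B])=s[C,D]$. The measure $|AB|$ of closed line segments of an Erlangen circle is normalized by taking the right angle as unit: it is the non-negative real-valued function of closed line segments that is equal on congruent segments, is additive ($|AB|=|AC|+|CB|$ whenever $C\in s[A,B]$), equals $1$ when $A,B$ form a right angle, and equals $2$ when $A,B$ are antipodal. An isometry between Erlangen circles is a function preserving measures of closed line segments: $|f(X)f(Y)|=|XY|$ for all points $X,Y$. *)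

(* Defs.v *)
From mathcomp Require Import all_boot all_order all_algebra.
From mathcomp Require Import boolp classical_sets reals.

Set Implicit Arguments.
Unset Strict Implicit.
Unset Printing Implicit Defensive.

Import Order.TTheory GRing.Theory Num.Theory.
Local Open Scope classical_set_scope.
Local Open Scope ring_scope.

(* [s A B] is the set of all points between [A] and [B], so that
   "C is between A and B" reads [s A B C]. *)
Record is_betweenness (T : Type) (s : T -> T -> set T) : Prop := IsBetweenness {
  btw_end : forall A B, s A B A ;
  btw_sym : forall A B C, s B C A -> s C B A ;
  btw_split : forall A B C, s A B C -> s A B = s A C `|` s C B ;
  btw_meet : forall A B C, s A B C -> s A C `&` s C B = s C C ;
  btw_point : forall A B C, s A B C -> s C C = [set C] }.

Section Betweenness.
Variables (T : Type) (s : T -> T -> set T).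

Definition is_segment (S : set T) : Prop := exists A B, S = s A B.

Definition is_convex (S : set T) : Prop :=
  forall A B, S A -> S B -> s A B `<=` S.

Definition is_connected (S : set T) : Prop :=
  forall U V, is_convex U -> is_convex V -> U !=set0 -> V !=set0 ->
    U `&` V = set0 -> S = U `|` V ->
    (is_segment U /\ ~ is_segment V) \/ (~ is_segment U /\ is_segment V).

Definition is_line : Prop :=
  [/\ is_betweenness s,
      exists A B : T, A <> B &
      forall A : T, exists c1 c2 : set T,
        [/\ is_convex c1 /\ is_convex c2,
            c1 !=set0 /\ c2 !=set0,
            c1 `&` c2 = set0,
            ~` [set A] = c1 `|` c2 &
            forall B C, c1 B -> c2 C -> s B C A]].

Definition is_isomorphism (f : T -> T) : Prop :=
  bijective f /\ forall A B, f @` s A B = s (f A) (f B).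

End Betweenness.

(* The subset [l], seen as a type, with the betweenness it inherits. *)
Definition inherited (T : Type) (s : T -> T -> set T) (l : set T)
    (A B : l) : set l :=
  [set C | s (\val A) (\val B) (\val C)].

Definition splits (T : Type) (s : T -> T -> set T) (a : T -> T) (A : T)
    (l1 l2 : set T) : Prop :=
  [/\ is_convex s l1 /\ is_convex s l2,
      l1 !=set0 /\ l2 !=set0,
      l1 `&` l2 = set0,
      ~` [set A; a A] = l1 `|` l2 &
      is_line (@inherited T s l1) /\ is_line (@inherited T s l2)].

Record is_circle (T : Type) (s : T -> T -> set T) (a : T -> T) : Prop :=
  IsCircle {
  circle_btw : is_betweenness s ;
  circle_three : exists A B C : T, [/\ A <> B, B <> C & A <> C] ;
  circle_antipode :
    forall A, exists P Q : T, P <> Q /\ s A (a A) = [set P; Q] ;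
  circle_connected : forall A B, B <> a A -> is_connected s (s A B) ;
  circle_split : forall A, exists l1 l2, splits s a A l1 l2 }.

(* The antipodal map is determined by [seg]: if [s A B] has exactly two points
   and [B] is not [antipode A], then [s A B] is the union of the two closed
   line segments [s A A] and [s B B], hence is not connected. *)
Record circle := Circle {
  point :> Type ;
  seg : point -> point -> set point ;
  antipode : point -> point ;
  circleP : is_circle seg antipode }.

(* [splits] is symmetric in [l1] and [l2], so both rays are covered. *)
Definition ray_from (c : circle) (A : c) (r : set c) : Prop :=
  exists l1 l2, splits (@seg c) (@antipode c) A l1 l2 /\ r = [set A] `|` l1.

Definition maximal_ray (c : circle) (r : set c) : Prop :=
  exists A, ray_from A r.

Record is_isomorphism_group (c : circle) (I : set (c -> c)) : Prop :=
  IsIsomorphismGroup {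
  igroup_iso : forall f, I f -> is_isomorphism (@seg c) f ;
  igroup_id : I id ;
  igroup_comp : forall f g, I f -> I g -> I (f \o g) ;
  igroup_inv : forall f, I f -> exists g, [/\ I g, cancel f g & cancel g f] }.

Record erlangen_circle := ErlangenCircle {
  base :> circle ;
  motions : set (base -> base) ;
  motions_group : is_isomorphism_group motions ;
  motions_rays : forall r1 r2 : set base,
    maximal_ray r1 -> maximal_ray r2 ->
    exists! f, motions f /\ f @` r1 = r2 }.

Section Measure.
Variable E : erlangen_circle.

Definition is_reflection (A : E) (i : E -> E) : Prop :=
  motions i /\
  exists l1 l2, [/\ splits (@seg E) (@antipode E) A l1 l2,
    i @` ([set A] `|` l1) = [set A] `|` l2 &
    i @` ([set A] `|` l2) = [set A] `|` l1].

Definition right_angle (A B : E) : Prop :=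
  exists i, is_reflection A i /\ i B = antipode B.

Definition congruent (A B C D : E) : Prop :=
  exists t, motions t /\ t @` seg A B = seg C D.

(* [mu A B] stands for |AB|.  That it only depends on the set [seg A B] is the
   case [t = id] of [measure_congruent]. *)
Record is_measure (R : realType) (mu : E -> E -> R) : Prop := IsMeasure {
  measure_ge0 : forall A B, 0 <= mu A B ;
  measure_congruent : forall A B C D, congruent A B C D -> mu A B = mu C D ;
  measure_additive : forall A B C, seg A B C -> mu A B = mu A C + mu C B ;
  measure_right_angle : forall A B, right_angle A B -> mu A B = 1 ;
  measure_antipode : forall A, mu A (antipode A) = 2 }.

End Measure.

(* "The" measure is a definite description: being an isometry includes that
   both circles have one and only one measure. *)
Definition is_isometry (R : realType) (E1 E2 : erlangen_circle)
    (f : E1 -> E2) : Prop :=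
  exists (mu1 : E1 -> E1 -> R) (mu2 : E2 -> E2 -> R),
    [/\ unique (@is_measure E1 R) mu1,
        unique (@is_measure E2 R) mu2 &
        forall X Y, mu2 (f X) (f Y) = mu1 X Y].

(* Main.v *)
Require Import Defs.
From mathcomp Require Import all_boot all_order all_algebra.
From mathcomp Require Import boolp classical_sets reals.
From mathcomp Require Import archimedean zify lra.

(* Removing [A] and its antipode from a circle leaves two lines; they are dense,
   Dedekind complete and linearly ordered from [A] to [a A].  This needs an
   argument: the line axioms alone do not exclude branching, but a branch point
   or a loop can be cut at a suitable point, and the two sides of that point
   contradict the fact that the antipodal map exchanges sides.

   A motion is determined by the image of one ray, and by Knaster-Tarski it
   cannot map a segment into a proper part of itself unless it is the identity.
   Hence segments have midpoints, each half circle has a midpoint, and points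
   form a right angle exactly in this situation.  Halving a quarter circle
   repeatedly gives units [2^-n]; counting how many non-overlapping units fit
   into a segment and letting [n] grow gives a measure, additive because cutting
   a segment loses at most one unit.  Halving also shows that any two measures
   agree, and completeness that every value in [[0, 2]] is attained on each half
   circle.  So the distance to [A] is a coordinate on each half circle, distances
   are determined by coordinates, and matching coordinates is an isometry. *)

Set Implicit Arguments.
Unset Strict Implicit.
Unset Printing Implicit Defensive.

Import Order.TTheory GRing.Theory Num.Theory.
Local Open Scope classical_set_scope.
Local Open Scope ring_scope.

(** * Segments *)

Section BetweennessTheory.
Variables (T : Type) (s : T -> T -> set T) (bs : is_betweenness s).

Lemma btwC A B C : s A B C -> s B A C.
Proof. exact: btw_sym. Qed.

Lemma btw_l A B : s A B A.
Proof. exact: btw_end. Qed.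

Lemma btw_r A B : s A B B.
Proof. by apply: btwC; apply: btw_l. Qed.

Lemma btw_id A B : s A A B -> B = A.
Proof. by rewrite (btw_point bs (btw_l A A)). Qed.

Lemma btw_common A B C X : s A B C -> s A C X -> s C B X -> X = C.
Proof.
move=> hC h1 h2; have : (s A C `&` s C B) X by [].
by rewrite (btw_meet bs hC) (btw_point bs hC).
Qed.

Lemma btw_case A B C D : s A B C -> s A B D -> s A C D \/ s C B D.
Proof. by move=> hC; rewrite {1}(btw_split bs hC). Qed.

Lemma btw_anti A B C : s A C B -> s A B C -> B = C.
Proof. by move=> h1 h2; rewrite (btw_common h1 h2 (btw_r _ _)). Qed.

Lemma btw_trans A B C D : s A B C -> s A C D -> s A B D.
Proof. by move=> hC hD; rewrite (btw_split bs hC); left. Qed.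

Lemma btw_trans_r A B C D : s A B C -> s A C D -> s D B C.
Proof.
move=> hC hD; have [h|//] := btw_case (btw_trans hC hD) hC.
by rewrite (btw_anti hD h); apply: btw_l.
Qed.

Lemma btw_total A B C D : s A B C -> s A B D -> s A C D \/ s A D C.
Proof.
move=> hC hD; have [|h] := btw_case hC hD; first by left.
by right; apply: btwC; apply: btw_trans_r (btwC hC) (btwC h).
Qed.

Lemma btw_convex A B C D X : s A B C -> s A B D -> s C D X -> s A B X.
Proof.
move=> hC hD hX; have [h|h] := btw_total hC hD.
  by apply: btw_trans hC _; apply: btwC; apply: btw_trans (btwC h) hX.
by apply: btw_trans hD _; apply: btwC; apply: btw_trans (btwC h) (btwC hX).
Qed.

Lemma seg_sym A B : s A B = s B A.
Proof. by apply/seteqP; split => X; apply: btwC. Qed.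

(** Whichever of [A], [B] comes first on the other segment must be an end of it. Congruence compares
    segments as sets, and this recovers the ends. *)
Lemma seg_inj A B C D : s A B = s C D -> (A = C /\ B = D) \/ (A = D /\ B = C).
Proof.
have key A' B' C' D' : s A' B' = s C' D' -> s C' B' A' -> A' = C' /\ B' = D'.
  move=> e h; split.
    apply: (@btw_anti B'); first exact: btwC.
    by apply: btwC; rewrite e; apply: btw_l.
  apply: (@btw_anti A'); last by rewrite e; apply: btw_r.
  by apply: btw_trans_r h; rewrite -e; apply: btw_r.
move=> e.
have hA : s C D A by rewrite -e; apply: btw_l.
have hB : s C D B by rewrite -e; apply: btw_r.
have [h|h] := btw_total hA hB.
  by right; apply/and_comm; apply: key h; rewrite seg_sym.
by left; apply: key h.
Qed.

(** Dedekind completeness: connectedness makes the initial part [D] or the rest of the segment a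
    closed segment, and one of its ends is the cut [M], which may belong to either part. *)
Lemma seg_cut A B (D : set T) : is_connected s (s A B) -> D A ->
  (forall X Y, s A B Y -> D Y -> s A Y X -> D X) ->
  exists M, [/\ s A B M, forall X, s A M X -> X <> M -> D X
    & forall X, s M B X -> X <> M -> ~ D X].
Proof.
move=> conn DA down; have [DB|nDB] := pselect (D B).
  exists B; split; first exact: btw_r.
    by move=> X hX _; apply: down hX => //; apply: btw_r.
  by move=> X /btw_id.
pose U := s A B `&` D; pose V := s A B `\` D.
have cU : is_convex s U.
  move=> P Q [hP DP] [hQ DQ] X hX.
  have hX' := btw_convex hP hQ hX; split=> //.
  have [h|h] := btw_total hP hQ.
    by apply: (down _ P) => //; apply: btwC; apply: btw_trans (btwC h) hX.
  by apply: (down _ Q) => //; apply: btwC; apply: btw_trans (btwC h) (btwC hX).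
have cV : is_convex s V.
  move=> P Q [hP DP] [hQ DQ] X hX.
  have hX' := btw_convex hP hQ hX; split=> // DX.
  have [h|h] := btw_total hP hQ.
    apply: DQ; apply: (down _ X) => //; apply: btwC.
    by apply: btw_trans_r (btwC h) (btwC (btwC hX)).
  by apply: DP; apply: (down _ X) => //; apply: btwC;
    apply: btw_trans_r (btwC h) (btwC hX).
have UA : U A by split=> //; apply: btw_l.
have VB : V B by split=> //; apply: btw_r.
have dUV : U `&` V = set0 by apply/seteqP; split=> // X [[_ ?] [_ ?]].
have eUV : s A B = U `|` V.
  apply/seteqP; split=> X; last by case=> -[].
  by move=> hX; have [?|?] := pselect (D X); [left|right].
(* A closed initial part starts at [A], and its far end is the cut. *)
have segU E F : U = s E F -> s A F E ->
    exists M, [/\ s A B M, forall X, s A M X -> X <> M -> D X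
    & forall X, s M B X -> X <> M -> ~ D X].
  move=> eU h; have eA : E = A.
    apply: (@btw_anti F); first exact: btwC.
    by apply: btwC; rewrite -eU.
  subst E.
  have UF : U F by rewrite eU; apply: btw_r.
  exists F; split; first by case: UF.
    by move=> X; rewrite -eU => -[].
  move=> X hX XF DX; apply: XF; case: UF => hF _.
  apply: (btw_common hF) => //; rewrite -eU; split=> //.
  by apply: btw_convex hF (btw_r _ _) hX.
(* A closed final part ends at [B], and its near end is the cut. *)
have segV E F : V = s E F -> s A F E ->
    exists M, [/\ s A B M, forall X, s A M X -> X <> M -> D X
    & forall X, s M B X -> X <> M -> ~ D X].
  move=> eV h.
  have VF : V F by rewrite eV; apply: btw_r.
  have eF : F = B.
    apply: (@btw_anti A); first by case: VF.
    by apply: btw_convex h (btw_r _ _) _; rewrite -eV.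
  subst F.
  have VE : V E by rewrite eV; apply: btw_l.
  exists E; split=> //.
    move=> X hX XE; apply: contrapT => nDX; apply: XE.
    apply: (btw_common h) => //; rewrite -eV; split=> //.
    exact: btw_trans h hX.
  by move=> X; rewrite -eV => -[].
case: (conn U V cU cV) => //; try by [exists A|exists B].
- case=> -[E [F eU]] _.
  have hE : s A B E by have [] : U E by rewrite eU; apply: btw_l.
  have hF : s A B F by have [] : U F by rewrite eU; apply: btw_r.
  have [h|h] := btw_total hE hF; last exact: segU h.
  by apply: segU h; rewrite seg_sym.
- case=> _ [E [F eV]].
  have hE : s A B E by have [] : V E by rewrite eV; apply: btw_l.
  have hF : s A B F by have [] : V F by rewrite eV; apply: btw_r.
  have [h|h] := btw_total hE hF; last exact: segV h.
  by apply: segV h; rewrite seg_sym.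
Qed.

End BetweennessTheory.

(** * Circles *)

Section CircleTheory.
Variables (T : Type) (s : T -> T -> set T) (a : T -> T).
Hypothesis circ : is_circle s a.
Let bs := circle_btw circ.
Local Notation btwC := (btwC bs).
Local Notation btw_l := (btw_l bs).
Local Notation btw_r := (btw_r bs).
Local Notation btw_id := (btw_id bs).
Local Notation btw_common := (btw_common bs).
Local Notation btw_case := (btw_case bs).
Local Notation btw_anti := (btw_anti bs).
Local Notation btw_trans := (btw_trans bs).
Local Notation btw_trans_r := (btw_trans_r bs).
Local Notation btw_total := (btw_total bs).
Local Notation btw_convex := (btw_convex bs).

(** * Antipodes *)

Lemma antipode_neq A : a A <> A.
Proof.
move=> e; have [P [Q [PQ eS]]] := circle_antipode circ A; apply: PQ.
have h X : [set P; Q] X -> X = A by rewrite -eS e; apply: btw_id.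
have -> : P = A by apply: h; left.
by symmetry; apply: h; right.
Qed.

Lemma seg_antipode A X : s A (a A) X -> X = A \/ X = a A.
Proof.
have [P [Q [PQ eS]]] := circle_antipode circ A.
have := btw_l A (a A); have := btw_r A (a A); have := @antipode_neq A.
rewrite eS => nA [e1|e1] [e2|e2] [->|->]; rewrite -?e1 -?e2; auto.
  by case: nA; rewrite e1 e2.
by case: nA; rewrite e1 e2.
Qed.

Lemma two_segments A B C D E F : B <> a A -> s C D `&` s E F = set0 ->
  s A B <> s C D `|` s E F.
Proof.
move=> BA d e.
have c X Y : is_convex s (s X Y).
  by move=> P Q hP hQ Z; apply: btw_convex.
case: (circle_connected circ BA (c C D) (c E F) _ _ d e).
- by exists C; apply: btw_l.
- by exists E; apply: btw_l.
- by case=> _; apply; exists E, F.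
- by case=> + _; apply; exists C, D.
Qed.

(** Otherwise [s A B] is the disjoint union of [s A A] and [s B B]. *)
Lemma seg_dense A B : A <> B -> B <> a A ->
  exists C, [/\ s A B C, C <> A & C <> B].
Proof.
move=> AB BA; apply: contrapT => h.
apply: (@two_segments A B A A B B BA).
  by apply/seteqP; split=> // X [/btw_id -> /btw_id].
apply/seteqP; split=> X; last first.
  by case=> /btw_id ->; [apply: btw_l|apply: btw_r].
move=> hX; apply: contrapT => n; apply: h; exists X; split=> // e; apply: n;
  rewrite e; [left|right]; exact: btw_l.
Qed.

Lemma antipodeK A : a (a A) = A.
Proof.
apply: contrapT => n.
have [|C [hC]] := @seg_dense (a A) A (@antipode_neq A); first by move=> /esym.
by have [->|->] := seg_antipode (btwC hC).
Qed.

(** As [s A (a A)] has only two points, [s A X] would otherwise be the disjoint union of [s A A] and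
    [s (a A) X]. *)
Lemma antipode_out A X : s A X (a A) -> X = a A.
Proof.
move=> h; apply: contrapT => n; apply: (@two_segments A X A A (a A) X n).
  apply/seteqP; split=> // Y [/btw_id -> hA].
  by apply: (@antipode_neq A); apply/esym; apply: btw_common h (btw_l _ _) hA.
apply/seteqP; split=> Y.
  move=> hY; have [|] := btw_case h hY; last by right.
  by case/seg_antipode => ->; [left; apply: btw_l|right; apply: btw_l].
case=> [/btw_id ->|hY]; first exact: btw_l.
exact: btw_convex h (btw_r _ _) hY.
Qed.

(** By [antipode_out], an antipodal pair on the segment would have [A] as a member; then [a A] lies
    on [s A B], which forces [B = a A]. *)
Lemma btw_antipode A B X Y : B <> a A -> s A B X -> s A B Y -> Y <> a X.
Proof.
move=> BA hX hY e; subst Y; apply: BA; apply: antipode_out.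
have [h|h] := btw_total hX hY.
  by have -> : a A = X by rewrite (antipode_out (btwC h)) antipodeK.
suff e : A = X by rewrite (_ : a A = a X) // e.
rewrite -(antipodeK X); apply: antipode_out.
by rewrite antipodeK; apply: btwC.
Qed.

(** * Open half circles *)

Definition half A l := exists l', splits s a A l l'.

Lemma splitsC A l1 l2 : splits s a A l1 l2 -> splits s a A l2 l1.
Proof.
case=> -[? ?] [? ?] d u [? ?]; split; [by []|by []| | |by []].
  by rewrite setIC.
by rewrite u setUC.
Qed.

Lemma splits_antipode A l1 l2 : splits s a A l1 l2 -> splits s a (a A) l1 l2.
Proof.
case=> c n d u h; split=> //; rewrite -u antipodeK; congr (~` _).
by apply/seteqP; split=> X [->|->]; [right|left|right|left].
Qed.

Lemma splits_cover A l1 l2 X : splits s a A l1 l2 ->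
  X <> A -> X <> a A -> l1 X \/ l2 X.
Proof.
by case=> _ _ _ u _ n1 n2; change ((l1 `|` l2) X); rewrite -u => -[].
Qed.

Lemma splits_disj A l1 l2 X : splits s a A l1 l2 -> l1 X -> ~ l2 X.
Proof. by case=> _ _ d _ _ h1 h2; have : (l1 `&` l2) X by []; rewrite d. Qed.

Lemma splits_ex A X : X <> A -> X <> a A ->
  exists l1 l2, splits s a A l1 l2 /\ l1 X.
Proof.
move=> n1 n2; have [l1 [l2 sp]] := circle_split circ A.
case: (splits_cover sp n1 n2) => h; first by exists l1, l2.
by exists l2, l1; split=> //; apply: splitsC.
Qed.

Lemma splits_half A l1 l2 : splits s a A l1 l2 -> half A l1.
Proof. by exists l2. Qed.

Lemma half_convex A l X Y Z : half A l -> l X -> l Y -> s X Y Z -> l Z.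
Proof. by case=> l' [[c _] _ _ _ _] hX hY; apply: c. Qed.

Lemma half_neq A l X : half A l -> l X -> X <> A /\ X <> a A.
Proof.
case=> l' [_ _ _ u _] hX; have : (~` [set A; a A]) X by rewrite u; left.
by move=> n; split=> e; apply: n; [left|right].
Qed.

Lemma half_nonempty A l : half A l -> exists X, l X.
Proof. by case=> l' [_ [] ]. Qed.

(** The line axiom concerns the subtype of points of [l]; its two sides are lifted to sets of points
    of the circle. The last clause is convexity, since [P] is on neither side. *)
Lemma half_sides A l P : half A l -> l P -> exists c1 c2 : set T,
  [/\ forall X, l X -> X <> P -> c1 X \/ c2 X,
      exists X Y, [/\ l X, l Y, c1 X & c2 Y],
      forall X Y, c1 X -> c2 Y -> s X Y P &
      forall X Y, (c1 X /\ c1 Y) \/ (c2 X /\ c2 Y) -> ~ s X Y P].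
Proof.
case=> l' [_ _ _ _ [[_ _ hl] _]] lP.
have [c1 [c2 [[cv1 cv2] [[B cB] [C cC]] _ u hb]]] :=
  hl (exist _ P (mem_set lP)).
pose lift (c : set l) X := exists2 Y, c Y & \val Y = X.
have nP (c : set l) : is_convex (@inherited T s l) c ->
    ~ c (exist _ P (mem_set lP)) ->
    forall X Y, lift c X -> lift c Y -> ~ s X Y P.
  by move=> cv n X Y [X' cX <-] [Y' cY <-] h; apply: n; exact: (cv X' Y').
have out : ~ (c1 `|` c2) (exist _ P (mem_set lP)).
  by rewrite -u; apply; reflexivity.
exists (lift c1), (lift c2); split.
- move=> X lX XP; have : (c1 `|` c2) (exist _ X (mem_set lX)).
    by rewrite -u => -[].
  by case=> h; [left|right]; exists (exist _ X (mem_set lX)).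
- exists (\val B), (\val C); split.
  + by case: B cB => B lB /= _; apply: set_mem.
  + by case: C cC => C lC /= _; apply: set_mem.
  + by exists B.
  + by exists C.
- by move=> X Y [X' cX <-] [Y' cY <-]; apply: (hb X' Y').
- move=> X Y [[hX hY]|[hX hY]].
    by apply: (nP c1) => // ?; apply: out; left.
  by apply: (nP c2) => // ?; apply: out; right.
Qed.

Lemma half_around A l P : half A l -> l P ->
  exists X Y, [/\ l X, l Y, X <> P, Y <> P & s X Y P].
Proof.
move=> hl lP; have [c1 [c2 [_ [X [Y [lX lY cX cY]]] hb hn]]] := half_sides hl lP.
exists X, Y; split=> //; last exact: hb.
  by move=> e; apply: (hn X X); [left|rewrite -e; apply: btw_l].
by move=> e; apply: (hn Y Y); [right|rewrite -e; apply: btw_l].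
Qed.

(** [P] separates exactly the points on different sides of it, and [Z] cannot share a side with both
    [X] and [Y]. *)
Lemma half_or A l P X Y Z : half A l -> l P -> l X -> l Y -> l Z ->
  X <> P -> Y <> P -> Z <> P -> s X Y P -> s X Z P \/ s Y Z P.
Proof.
move=> hl lP lX lY lZ nX nY nZ h.
have [c1 [c2 [cov _ hb hn]]] := half_sides hl lP.
case: (cov X) => // cX; case: (cov Y) => // cY; case: (cov Z) => // cZ;
  try by [case: (hn X Y); auto]; try by [left; auto]; try by [right; auto].
- by right; apply/btwC; auto.
- by left; apply/btwC; auto.
Qed.

(** Pigeonhole: two of the three points share a side of [P]. *)
Lemma half_not3 A l P X Y Z : half A l -> l P -> l X -> l Y -> l Z ->
  X <> P -> Y <> P -> Z <> P -> s X Y P -> s X Z P -> ~ s Y Z P.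
Proof.
move=> hl lP lX lY lZ nX nY nZ h1 h2 h3.
have [c1 [c2 [cov _ hb hn]]] := half_sides hl lP.
case: (cov X) => // cX; case: (cov Y) => // cY; case: (cov Z) => // cZ;
  by [case: (hn X Y); auto|case: (hn X Z); auto|case: (hn Y Z); auto].
Qed.

(* If [X] and [a X] were in the same line, a point beyond [X] would have [X]
   between itself and [a X], against [antipode_out]. *)
Lemma half_antipode A l X Y : half A l -> l X -> l Y -> Y <> a X.
Proof.
move=> hl lX lY e; subst Y.
have [U [V [lU lV UX VX h]]] := half_around hl lX.
have no W : W <> X -> ~ s W (a X) X.
  move=> n hW; apply: n; rewrite -(antipodeK X); apply: antipode_out.
  by rewrite antipodeK; apply: btwC.
have := half_or hl lX lU lV lY UX VX (@antipode_neq X) h.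
by case; apply: no.
Qed.

Lemma splits_swap A l1 l2 X : splits s a A l1 l2 -> l1 X -> l2 (a X).
Proof.
move=> sp lX; have [n1 n2] := half_neq (splits_half sp) lX.
case: (splits_cover sp (X := a X)) => //.
- by move=> e; apply: n2; rewrite -e antipodeK.
- by move=> e; apply: n1; rewrite -(antipodeK X) e antipodeK.
- by move=> h; case: (half_antipode (splits_half sp) lX h).
Qed.

Lemma half_cut A l X Y (D : set T) : half A l -> l X -> l Y -> D X ->
  (forall P Q, s X Y Q -> D Q -> s X Q P -> D P) ->
  exists M, [/\ s X Y M, forall P, s X M P -> P <> M -> D P
    & forall P, s M Y P -> P <> M -> ~ D P].
Proof.
move=> hl lX lY; apply: (seg_cut bs); apply: (circle_connected circ).
exact: half_antipode hl lX lY.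
Qed.

Lemma half_dense A l X Y : half A l -> l X -> l Y -> X <> Y ->
  exists Z, [/\ s X Y Z, Z <> X, Z <> Y & l Z].
Proof.
move=> hl lX lY n; have [Z [h1 h2 h3]] := seg_dense n (half_antipode hl lX lY).
by exists Z; split=> //; apply: half_convex hl lX lY h1.
Qed.

(** * Absence of branching *)

(** Excludes a doubled point. A point [X] strictly between [p] and [g] lies between [V] and one of
    them, say [p]. A point strictly between [X] and [p] is then also on [s V g], hence on both sides
    of [X] in [s p g]. *)
Lemma hausdorff_half A l V p g : half A l -> l V -> l p -> l g ->
  (forall X, (s V p X /\ X <> p) <-> (s V g X /\ X <> g)) -> p = g.
Proof.
move=> hl lV lp lg h; apply: contrapT => pg.
have key p' g' X : l p' ->
    (forall Y, (s V p' Y /\ Y <> p') -> (s V g' Y /\ Y <> g')) ->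
    s p' g' X -> s V p' X -> X <> p' -> X <> g' -> l X -> False.
  move=> lp' h' hX hV Xp Xg lX.
  have [U [hU Up UX lU]] := half_dense hl lp' lX (nesym Xp).
  have hVU : s V p' U := btwC (btw_trans (btwC hV) hU).
  have [hU' _] := h' _ (conj hVU Up).
  apply: UX; apply: (btw_common hX) => //.
  by apply: btw_trans_r hU' _; apply: btwC; apply: btw_trans_r (btwC hV) hU.
have [X [hX Xp Xg lX]] := half_dense hl lp lg pg.
have k1 := key p g X lp (fun Y => (h Y).1).
have k2 := key g p X lg (fun Y => (h Y).2).
have [e|VX] := pselect (V = X).
  by apply: k1 => //; rewrite -e; apply: btw_l.
case: (half_or hl lX lp lg lV _ _ _ hX); try exact: nesym; move=> hh //.
  by apply: k1 => //; apply: btwC.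
by apply: k2 => //; apply: btwC.
Qed.

Lemma btw_tail V p U X : s V p U -> s U p X <-> s V p X /\ s V X U.
Proof.
move=> hU; split=> [hX|[hX h]]; last exact: btw_trans_r hX h.
split; first exact: btw_convex hU (btw_r _ _) hX.
by apply: btwC; apply: btw_trans_r (btwC hU) (btwC hX).
Qed.

(** Split at a point [W] strictly inside [s V p]: both [p] and [g] are on the side away from [V],
    and [U], strictly between [W] and [p], replaces [V] as base point. *)
Lemma hausdorff V p g : V <> p -> p <> a V -> g <> a V ->
  (forall X, (s V p X /\ X <> p) <-> (s V g X /\ X <> g)) -> p = g.
Proof.
move=> Vp pV gV h.
have [W [hW WV Wp]] := seg_dense Vp pV.
have [hW' Wg] := (h W).1 (conj hW Wp).
have pW := btw_antipode pV hW (btw_r V p).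
have VW := btw_antipode pV hW (btw_l V p).
have gW := btw_antipode gV hW' (btw_r V g).
have [n1 [n2 [sp n1p]]] := splits_ex (nesym Wp) pW.
have hn1 := splits_half sp; have hn2 := splits_half (splitsC sp).
have no1 : ~ n1 W by move=> /(half_neq hn1) [].
have no2 : ~ n2 W by move=> /(half_neq hn2) [].
have n2V : n2 V.
  case: (splits_cover sp (nesym WV) VW) => // n1V.
  by case: no1; apply: half_convex hn1 n1V n1p hW.
have n1g : n1 g.
  case: (splits_cover sp (nesym Wg) gW) => // n2g.
  by case: no2; apply: half_convex hn2 n2V n2g hW'.
have [U [hU UW Up]] := seg_dense Wp pW.
have hU' := btw_convex hW (btw_r _ _) hU.
have n1U : n1 U.
  case: (splits_cover sp UW (btw_antipode pV hW hU')) => // n2U.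
  case: no2; apply: half_convex hn2 n2U n2V _ => //.
  exact: btw_trans_r (btwC hW) (btwC hU).
apply: (@hausdorff_half _ _ U) hn1 n1U n1p n1g _ => X.
have [hU'' _] := (h U).1 (conj hU' Up).
have e1 := @btw_tail V p U X hU'; have e2 := @btw_tail V g U X hU''.
have hX := h X; tauto.
Qed.

(** Let [g] be the cut of [s V Z] at the end of the half-open segment from [V] to [M]. By density
    this has no last point, so [g] and [M] close the same half-open segment and [hausdorff]
    applies. *)
Lemma seg_closed V M Z : V <> M -> M <> a V -> Z <> a V ->
  (forall X, s V M X -> X <> M -> s V Z X) -> s V Z M.
Proof.
move=> VM MV ZV h; pose D := [set X | s V M X /\ X <> M].
have down P Q : D Q -> s V Q P -> D P.
  move=> [hQ QM] hP; split; first exact: btw_trans hQ hP.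
  by move=> e; subst P; apply: QM; apply: btw_anti hQ hP.
have [|P Q _|g [hg below above]] :=
    seg_cut bs (D := D) (circle_connected circ ZV).
- by split=> //; apply: btw_l.
- exact: down.
have nDg : ~ D g.
  move=> [gM1 gM2].
  have [U [hU Ug UM]] := seg_dense gM2 (btw_antipode MV gM1 (btw_r _ _)).
  have hU' := btw_convex gM1 (btw_r _ _) hU.
  apply: (above U) => //; apply: btw_trans_r (h U hU' UM) _.
  by apply: btwC; apply: btw_trans_r (btwC gM1) (btwC hU).
suff -> : M = g by [].
apply: (@hausdorff V) => //.
  by move=> e; apply: ZV; apply: antipode_out; rewrite -e.
move=> X; split=> [DX|[hX Xg]]; last exact: below.
have hX := h X DX.1 DX.2; have [hh|hh] := btw_total hg hX.
  by split=> // e; apply: nDg; rewrite -e.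
by case: nDg; apply: down DX hh.
Qed.

(** A point strictly between [M] and [V] separates [Z] from [M] or from [V], and the hypothesis
    excludes the former. So [s V Z] contains the half-open segment from [V] to [M], and [seg_closed]
    adds [M]. *)
Lemma half_tri A l M V Z : half A l -> l M -> l V -> l Z ->
  (forall X, s M V X -> s M Z X -> X = M) -> s V Z M.
Proof.
move=> hl lM lV lZ h.
have [->|VM] := pselect (V = M); first exact: btw_l.
apply: seg_closed => //; try exact: half_antipode hl _ _.
move=> X hX XM; have lX := half_convex hl lV lM hX.
have [->|XV] := pselect (X = V); first exact: btw_l.
have [->|XZ] := pselect (X = Z); first exact: btw_r.
have [] // := half_or hl lX lM lV lZ (nesym XM) (nesym XV) (nesym XZ) (btwC hX).
by move=> h'; case: XM; apply: h => //; apply: btwC.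
Qed.

(** The point [M] where [s X Y] and [s X Z] part lies between any two of the three points; by
    [half_not3] it is one of them. *)
Lemma half_total A l X Y Z : half A l -> l X -> l Y -> l Z ->
  [\/ s X Y Z, s X Z Y | s Y Z X].
Proof.
move=> hl lX lY lZ; pose D := [set P | s X Y P /\ s X Z P].
have [|P Q hQ [h1 h2] hP|M [hM below above]] := @half_cut _ _ _ _ D hl lX lY.
- by split; apply: btw_l.
- by split; [apply: btw_trans h1 hP|apply: btw_trans h2 hP].
have hM' : s X Z M.
  have [->|XM] := pselect (X = M); first exact: btw_l.
  apply: seg_closed => //.
  - exact: half_antipode hl lX (half_convex hl lX lY hM).
  - exact: half_antipode hl lX lZ.
  - by move=> P hP PM; case: (below P hP PM).
have lM := half_convex hl lX lY hM.
have h : s Y Z M.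
  apply: (half_tri hl) => // P h1 h2; apply: contrapT => PM.
  apply: (above P) => //; split.
    exact: btw_convex hM (btw_r _ _) h1.
  exact: btw_convex hM' (btw_r _ _) h2.
have [e|MX] := pselect (X = M); first by apply: Or33; rewrite e.
have [e|MY] := pselect (Y = M); first by apply: Or32; rewrite e.
have [e|MZ] := pselect (Z = M); first by apply: Or31; rewrite e.
by case: (half_not3 hl lM lX lY lZ MX MY MZ hM hM' h).
Qed.

(** [p] is a missing end of [l]: if [Z] lay in the direction of [p] but off [s p Y], the half-open
    segment from [Y] to [p] would lie in [s Y Z], and [seg_closed] would put [p] into [l]. *)
Lemma half_end A l p Y Z : half A l -> ~ l p -> Y <> p -> Y <> a p ->
  (forall X, s p Y X -> X <> p -> l X) -> l Z ->
  s p Y Z \/ forall V, s p Y V -> V <> p -> s V Z Y.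
Proof.
move=> hl nlp Yp Yap sub lZ.
have lY : l Y by apply: sub => //; apply: btw_r.
have [|nZ] := pselect (s p Y Z); first by left.
right=> V hV Vp; have lV := sub V hV Vp.
have [->|VY] := pselect (V = Y); first exact: btw_l.
have no X : s p Y X -> ~ s X Y Z.
  by move=> hX hZ; apply: nZ; apply: btw_convex hX (btw_r _ _) hZ.
have [/no -/(_ hV)//|//|h] := half_total hl lV lY lZ.
case: nlp; apply: (half_convex hl lY lZ); apply: seg_closed => //.
- by move=> e; apply: Yap; rewrite e antipodeK.
- exact: half_antipode hl lY lZ.
move=> X hX Xp; have [hh|hh] := btw_total (btwC hV) hX.
  exact: btw_trans h hh.
have lX := sub X (btwC hX) Xp.
have [/no -/(_ (btwC hX))//|h'|//] := half_total hl lX lY lZ.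
case: VY; apply/esym; apply: (@btw_anti Z); last exact: btwC.
by apply: btwC; apply: btw_trans_r h' (btwC hh).
Qed.

(* Two segments leaving [p] on the same side would otherwise form a loop based
   at [p]; cutting that loop at an interior point [W] of [s Y Z], the side of
   [W] not containing [p] lies inside the side of [p] containing the loop, so
   that side would contain the antipode of [p]. *)
Lemma splits_germ p m1 m2 Y Z : splits s a p m1 m2 -> Y <> p -> Z <> p ->
  (forall X, s p Y X -> X <> p -> m2 X) ->
  (forall X, s p Z X -> X <> p -> m2 X) -> s p Y Z \/ s p Z Y.
Proof.
move=> spp Yp Zp subY subZ.
have hm := splits_half (splitsC spp).
have mY : m2 Y by apply: subY => //; apply: btw_r.
have mZ : m2 Z by apply: subZ => //; apply: btw_r.
have nmp : ~ m2 p by move=> /(half_neq hm) [].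
have [_ Yap] := half_neq hm mY; have [_ Zap] := half_neq hm mZ.
apply: contrapT => /not_orP [nZ nY].
have [//|hY] := half_end hm nmp Yp Yap subY mZ.
have [//|hZ] := half_end hm nmp Zp Zap subZ mY.
have YZ : Y <> Z by move=> e; apply: nZ; rewrite e; apply: btw_r.
have [W [hW WY WZ mW]] := half_dense hm mY mZ YZ.
have Wap X : m2 X -> X <> a W by apply: half_antipode hm mW.
have key Y' Z' n1 n2 : m2 Y' -> m2 Z' -> Z' <> p -> W <> Z' ->
    (forall X, s p Z' X -> X <> p -> m2 X) ->
    (forall V, s p Z' V -> V <> p -> s V Y' Z') ->
    s Y' Z' W -> splits s a W n1 n2 -> n1 p -> n1 Y' -> n2 Z' -> False.
  move=> mY' mZ' Zp' WZ' subZ' hZ' hW' spW n1p n1Y n2Z.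
  have hn1 := splits_half spW; have hn2 := splits_half (splitsC spW).
  have [_ Zap'] := half_neq hm mZ'.
  have no1 : ~ n1 W by move=> /(half_neq hn1) [].
  have no2 : ~ n2 W by move=> /(half_neq hn2) [].
  have n2T := splits_swap spW n1p.
  have sub1 X : s W Z' X -> X <> W -> n2 X.
    move=> hX XW; have mX := half_convex hm mW mZ' hX.
    case: (splits_cover spW XW (Wap _ mX)) => // n1X.
    case: no1; apply: (half_convex hn1 n1X n1Y).
    exact: btw_trans_r (btwC hW') (btwC hX).
  have sub2 X : s p Z' X -> X <> p -> n2 X.
    move=> hX Xp; have mX := subZ' X hX Xp; have h := hZ' X hX Xp.
    have XW : X <> W.
      move=> e; subst X; apply: WZ'; apply: btw_anti (btwC h) => //.
    case: (splits_cover spW XW (Wap _ mX)) => // n1X.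
    case: no1; apply: (half_convex hn1 n1X n1Y); apply: btwC.
    exact: btw_trans (btwC h) hW'.
  have [|e1] := half_end hn2 no2 (nesym WZ') (Wap _ mZ') sub1 n2T.
    by move=> h; have [] := half_neq hm (half_convex hm mW mZ' h).
  have [|e2] := half_end hn2 (fun h => splits_disj spW n1p h) Zp' Zap' sub2 n2T.
    by move=> /antipode_out.
  have [V [hV VW VZ mV]] := half_dense hm mW mZ' WZ'.
  have [V' [hV' Vp' VZ']] := seg_dense (nesym Zp') Zap'.
  have n2V := sub1 V hV VW; have n2V' := sub2 V' hV' Vp'.
  (* [Z'] would separate any two of [a p], [V] and [V']. *)
  apply: (half_not3 hn2 n2Z n2T n2V n2V' (nesym Zap') VZ VZ').
  - by apply: btwC; apply: e1.
  - by apply: btwC; apply: e2.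
  - apply: btw_trans_r (btwC (hZ' V' hV' Vp')) _.
    exact: btw_convex hW' (btw_r _ _) hV.
have [n1 [n2 [spW n1Y]]] := splits_ex (nesym WY) (Wap _ mY).
have n2Z : n2 Z.
  case: (splits_cover spW (nesym WZ) (Wap _ mZ)) => // n1Z.
  have [] := half_neq (splits_half spW) (half_convex (splits_half spW) n1Y n1Z hW).
  by [].
have pW : p <> W by move=> e; apply: nmp; rewrite e.
have paW : p <> a W.
  by move=> e; have [_] := half_neq hm mW; rewrite e antipodeK.
case: (splits_cover spW pW paW) => hp.
  exact: (key Y Z n1 n2).
exact: (key Z Y n2 n1 _ _ _ _ _ _ (btwC hW) (splitsC spW)).
Qed.

(** If the segment leaves the side of [Y] at [Z], convexity keeps everything from [p] to [Z] off
    that side. *)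
Lemma germ_side p m1 m2 Y : splits s a p m1 m2 -> Y <> p -> Y <> a p ->
  exists Y', [/\ s p Y Y', Y' <> p &
    (forall X, s p Y' X -> X <> p -> m1 X) \/
    (forall X, s p Y' X -> X <> p -> m2 X)].
Proof.
move=> sp Yp Yap.
have key n1 n2 : splits s a p n1 n2 -> n1 Y ->
  exists Y', [/\ s p Y Y', Y' <> p &
    (forall X, s p Y' X -> X <> p -> n1 X) \/
    (forall X, s p Y' X -> X <> p -> n2 X)].
  move=> spn nY.
  have [h|] := pselect (forall X, s p Y X -> X <> p -> n1 X).
    by exists Y; split=> //; [apply: btw_r|left].
  have Xap X : s p Y X -> X <> a p.
    by move=> h e; apply: Yap; apply: antipode_out; rewrite -e.
  move=> /existsNP [Z /not_implyP [hZ /not_implyP [Zp nZ]]].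
  exists Z; split=> //; right=> X hX Xp.
  have hX' := btw_trans hZ hX.
  case: (splits_cover spn Xp (Xap _ hX')) => // n1X; case: nZ.
  apply: (half_convex (splits_half spn) n1X nY).
  exact: btw_trans_r hZ hX.
case: (splits_cover sp Yp Yap) => h; first exact: (key _ _ sp).
have [Y' [h1 h2 h3]] := key _ _ (splitsC sp) h.
by exists Y'; split=> //; apply/or_comm.
Qed.

(** [l] contains segments from [p] on both sides of [p]. An initial piece of [s p Y] is on one of
    these sides, where [splits_germ] makes it overlap the segment of [l]. *)
Lemma half_noexit A l p Y : half A l -> l p -> Y <> p -> Y <> a p ->
  ~ (forall X, s p Y X -> l X -> X = p).
Proof.
move=> hl lp Yp Yap out.
have [Z1 [Z2 [lZ1 lZ2 Zp1 Zp2 hp]]] := half_around hl lp.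
have [m1 [m2 [sp m1Z]]] := splits_ex Zp1 (half_antipode hl lp lZ1).
have no1 : ~ m1 p by move=> /(half_neq (splits_half sp)) [].
have no2 : ~ m2 p by move=> /(half_neq (splits_half (splitsC sp))) [].
have m2Z : m2 Z2.
  case: (splits_cover sp Zp2 (half_antipode hl lp lZ2)) => // h.
  by case: no1; apply: half_convex (splits_half sp) m1Z h hp.
have sub1 X : s p Z1 X -> X <> p -> m1 X.
  move=> hX Xp; have lX := half_convex hl lp lZ1 hX.
  case: (splits_cover sp Xp (half_antipode hl lp lX)) => // h; case: no2.
  apply: half_convex (splits_half (splitsC sp)) h m2Z _.
  exact: btw_trans_r hp (btwC hX).
have sub2 X : s p Z2 X -> X <> p -> m2 X.
  move=> hX Xp; have lX := half_convex hl lp lZ2 hX.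
  case: (splits_cover sp Xp (half_antipode hl lp lX)) => // h; case: no1.
  apply: half_convex (splits_half sp) h m1Z _.
  exact: btw_trans_r (btwC hp) (btwC hX).
have [Y' [hY Yp' sub]] := germ_side sp Yp Yap.
have end1 Z : l Z -> Z <> p -> s p Y' Z \/ s p Z Y' -> False.
  move=> lZ Zp [h|h].
    by apply: Zp; apply: out => //; apply: btw_trans hY h.
  by apply: Yp'; apply: out => //; apply: half_convex hl lp lZ h.
case: sub => sub.
  exact: (end1 _ lZ1 Zp1 (splits_germ (splitsC sp) Yp' Zp1 sub sub1)).
exact: (end1 _ lZ2 Zp2 (splits_germ sp Yp' Zp2 sub sub2)).
Qed.

(** Cut the segment where it leaves [l1]. A cut point other than [A] and [a A] lies in an open half
    that the segment leaves at once, against [half_noexit]. *)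
Lemma splits_cross A l1 l2 X Y : splits s a A l1 l2 -> l1 X -> l2 Y ->
  Y <> a X -> s X Y A \/ s X Y (a A).
Proof.
move=> sp lX lY YX; apply: contrapT => /not_orP [nA naA].
have hl1 := splits_half sp; have hl2 := splits_half (splitsC sp).
have [//|P Q _ hQ hP|M [hM below above]] :=
    seg_cut bs (D := l1) (circle_connected circ YX).
  exact: half_convex hl1 lX hQ hP.
case: (splits_cover sp (X := M)).
- by move=> e; apply: nA; rewrite -e.
- by move=> e; apply: naA; rewrite -e.
- move=> lM; apply: (half_noexit hl1 lM (Y := Y)).
  + by move=> e; apply: (splits_disj sp lM); rewrite -e.
  + exact: btw_antipode YX hM (btw_r _ _).
  + by move=> P hP lP; apply: contrapT => PM; apply: (above P).
- move=> lM; apply: (half_noexit hl2 lM (Y := X)).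
  + by move=> e; apply: (splits_disj sp lX); rewrite e.
  + exact: btw_antipode YX hM (btw_l _ _).
  + move=> P hP lP; apply: contrapT => PM.
    by apply: (splits_disj sp (below P (btwC hP) PM)).
Qed.

(** Otherwise [s X V] crosses [A] or [a A], which the position of [V] on [s A X] excludes. *)
Lemma splits_ray A l1 l2 X V : splits s a A l1 l2 -> l1 X ->
  s A X V -> V <> A -> l1 V.
Proof.
move=> sp lX hV VA; have [XA XaA] := half_neq (splits_half sp) lX.
have VaA : V <> a A.
  by move=> e; apply: XaA; apply: antipode_out; rewrite -e.
case: (splits_cover sp VA VaA) => // lV.
have VX : V <> a X by apply: btw_antipode XaA (btw_r _ _) hV.
case: (splits_cross sp lX lV VX) => h.
  by case: VA; apply: btw_anti (btwC hV) h.
by case: XaA; apply: antipode_out; apply: btw_convex (btw_r _ _) hV h.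
Qed.

Lemma splits_total A l1 l2 X Z : splits s a A l1 l2 -> l1 X -> l1 Z ->
  s A X Z \/ s A Z X.
Proof.
move=> sp lX lZ; have hl := splits_half sp.
have [XA _] := half_neq hl lX; have [ZA _] := half_neq hl lZ.
by apply: (splits_germ (splitsC sp)) => // V;
  [apply: splits_ray sp lX|apply: splits_ray sp lZ].
Qed.

(* The orders from [A] and from [a A] are opposite: if they agreed on [l1], the
   half-open segments from [X] to [A] and to [a A] would coincide. *)
Lemma splits_opposite A l1 l2 X Z : splits s a A l1 l2 -> l1 X -> l1 Z ->
  s A Z X -> s X (a A) Z.
Proof.
move=> sp lX lZ h; have hl := splits_half sp.
have spa := splits_antipode sp.
have [XA XaA] := half_neq hl lX.
have [/btwC//|h'] := splits_total spa lX lZ.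
have [->|XZ] := pselect (X = Z); first exact: btw_l.
case: XA; rewrite -(antipodeK A); apply: antipode_out.
rewrite antipodeK; apply: btwC; apply: seg_closed.
- by case: (half_neq hl lX).
- by move=> e; apply: XaA; rewrite e antipodeK.
- by move=> e; apply: (half_neq hl lX).1; rewrite -(antipodeK A) e antipodeK.
move=> V hV VA; have lV := splits_ray sp lX (btwC hV) VA.
have hZ := btw_trans_r h (btwC hV).
have [/btwC//|hVX] := splits_total spa lX lV.
have [->|XV] := pselect (X = V); first exact: btw_l.
case: (splits_total spa lV lZ) => hh.
  by case: XZ; apply: btw_anti hZ (btwC (btw_trans_r hh h')).
case: XV; apply/esym; apply: (@btw_anti Z); last exact: btwC.
by apply: btwC; apply: btw_trans_r hh hVX.
Qed.

End CircleTheory.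

(** * Motions and reflections *)

Section Motions.
Variable E : erlangen_circle.
Local Notation s := (@seg E).
Local Notation a := (@antipode E).
Local Notation circ := (circleP E).
Local Notation bs := (circle_btw circ).
Local Notation I := (@motions E).
Local Notation btwC := (btwC bs).
Local Notation btw_l := (btw_l bs).
Local Notation btw_r := (btw_r bs).
Local Notation btw_anti := (btw_anti bs).
Local Notation btw_trans := (btw_trans bs).
Local Notation btw_trans_r := (btw_trans_r bs).
Local Notation btw_total := (btw_total bs).
Local Notation btw_convex := (btw_convex bs).
Local Notation antipode_neq := (antipode_neq circ).
Local Notation antipodeK := (antipodeK circ).
Local Notation btw_antipode := (btw_antipode circ).
Local Notation seg_dense := (seg_dense circ).
Local Notation half_antipode := (half_antipode circ).
Local Notation splits_ex := (splits_ex circ).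
Local Notation splits_ray := (splits_ray circ).
Local Notation splits_total := (splits_total circ).
Local Notation splits_swap := (splits_swap circ).
Local Notation splits_antipode := (splits_antipode circ).

Lemma motion_inj t : I t -> injective t.
Proof. by move=> /(igroup_iso (motions_group E)) [/bij_inj]. Qed.

Lemma motion_btw t A B X : I t -> s A B X -> s (t A) (t B) (t X).
Proof. by move=> /(igroup_iso (motions_group E)) [_ <-] h; exists X. Qed.

Lemma motion_comp t u : I t -> I u -> motions (t \o u).
Proof. exact: igroup_comp (motions_group E) _ _. Qed.

Lemma motion_inv t : I t ->
  exists u, [/\ I u, cancel t u & cancel u t].
Proof. exact: igroup_inv (motions_group E) _. Qed.

(** Only antipodal ends leave a segment without interior points. *)
Lemma motion_antipode t A : I t -> t (a A) = a (t A).
Proof.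
move=> mt; apply: contrapT => n.
have nA : t A <> t (a A).
  by move=> /(motion_inj mt) /esym; apply: antipode_neq.
have [X []] := seg_dense nA n.
have [_ <-] := igroup_iso (motions_group E) mt.
by case=> Y /(seg_antipode circ) [->|->] <-.
Qed.

(** A point of [l1] lies between two others, whereas [B] is not between two points of its ray
    [m1]. *)
Lemma motion_apex t A B l1 l2 m1 m2 : I t ->
  splits s a A l1 l2 -> splits s a B m1 m2 ->
  t @` ([set A] `|` l1) = [set B] `|` m1 -> t A = B.
Proof.
move=> mt spA spB e.
have hl := splits_half spA; have hm := splits_half spB.
have : ([set B] `|` m1) B by left.
rewrite -e => -[A' [->//|lA'] eA'].
have [U [V [lU lV UA VA h]]] := half_around circ hl lA'.
have img X : l1 X -> X <> A' -> m1 (t X).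
  move=> lX XA; have : (t @` ([set A] `|` l1)) (t X) by exists X => //; right.
  by rewrite e => -[eX|//]; case: XA; apply: (motion_inj mt); rewrite eA'.
have mU := img _ lU UA; have mV := img _ lV VA.
have := motion_btw mt h; rewrite eA' => hB.
have [nU _] := half_neq hm mU; have [nV _] := half_neq hm mV.
have [h'|h'] := splits_total spB mU mV.
  by case: nV; apply: btw_anti (btwC h') hB.
by case: nU; apply: btw_anti (btwC h') (btwC hB).
Qed.

(** [X] and [Y] are comparable from [A], so their images are comparable from [t A], and [splits_ray]
    keeps these on one side. *)
Lemma motion_side t A l1 l2 m1 m2 X Y : I t ->
  splits s a A l1 l2 -> splits s a (t A) m1 m2 ->
  l1 X -> m1 (t X) -> l1 Y -> m1 (t Y).
Proof.
move=> mt spA spB lX mX lY.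
have [nY nY'] := half_neq (splits_half spA) lY.
have tYA : t Y <> t A by move=> /(motion_inj mt).
have tYa : t Y <> a (t A) by rewrite -motion_antipode// => /(motion_inj mt).
case: (splits_cover spB tYA tYa) => // mY.
have [h|h] := splits_total spA lX lY.
  by apply: splits_ray spB mX (motion_btw mt h) _.
have [nX _] := half_neq (splits_half spB) mX.
have := splits_ray (splitsC spB) mY (motion_btw mt h) nX.
by move=> /(splits_disj spB mX).
Qed.

Lemma motion_ex A B l1 l2 m1 m2 : splits s a A l1 l2 -> splits s a B m1 m2 ->
  exists t, [/\ I t, t A = B & forall X, l1 X -> m1 (t X)].
Proof.
move=> spA spB.
have [||t [[mt e] _]] := @motions_rays E ([set A] `|` l1) ([set B] `|` m1).
- by exists A, l1, l2.
- by exists B, m1, m2.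
have eA := motion_apex mt spA spB e.
exists t; split=> // X lX.
have : (t @` ([set A] `|` l1)) (t X) by exists X => //; right.
rewrite e => -[eX|//]; have [+ _] := half_neq (splits_half spA) lX.
by case; apply: (motion_inj mt); rewrite eA.
Qed.

(** [t] and its inverse map the ray at [A] into itself, so [t] and [id] both map it onto itself;
    such a motion is unique. *)
Lemma motion_id t A l1 l2 X : I t -> splits s a A l1 l2 ->
  t A = A -> l1 X -> l1 (t X) -> t = id.
Proof.
move=> mt spA eA lX ltX.
have [u [mu tK uK]] := motion_inv mt.
have eA' : u A = A by rewrite -{1}eA tK.
have im v Y : I v -> v A = A -> l1 Y -> l1 (v Y) -> forall Z, l1 Z -> l1 (v Z).
  move=> mv ev lY lvY Z lZ; have spA' : splits s a (v A) l1 l2 by rewrite ev.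
  exact: motion_side mv spA spA' lY lvY lZ.
have e : t @` ([set A] `|` l1) = [set A] `|` l1.
  apply/seteqP; split=> Y.
    case=> Z [->|lZ] <-; first by left.
    by right; apply: im mt eA lX ltX _ lZ.
  case=> [->|lY]; first by exists A => //; left.
  exists (u Y) => //; right; apply: im mu eA' ltX _ _ lY.
  by rewrite tK.
have mr : maximal_ray ([set A] `|` l1) by exists A, l1, l2.
have [v [_ uniq]] := motions_rays mr mr.
rewrite -(uniq t (conj mt e)); apply: uniq; split; last exact: image_id.
exact: igroup_id (motions_group E).
Qed.

Lemma motion_fix t A X : I t -> t A = A -> X <> A -> X <> a A ->
  s A X (t X) \/ s A (t X) X -> t = id.
Proof.
move=> mt eA XA XaA h.
have [l1 [l2 [sp lX]]] := splits_ex XA XaA.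
have tXA : t X <> A by move=> e; apply: XA; apply: (motion_inj mt); rewrite eA.
apply: (motion_id mt sp eA lX).
case: h => h; first exact: (splits_ray sp lX).
have tXa : t X <> a A.
  by rewrite -{1}eA -motion_antipode// => /(motion_inj mt).
case: (splits_cover sp tXA tXa) => // mX.
by have /(splits_disj sp lX) := splits_ray (splitsC sp) mX h XA.
Qed.

Lemma motion_eq t u A l1 l2 m1 m2 X : I t -> I u ->
  splits s a A l1 l2 -> splits s a (t A) m1 m2 -> u A = t A ->
  l1 X -> m1 (t X) -> m1 (u X) -> t = u.
Proof.
move=> mt mu spA spB e lX mtX muX.
have [v [mv tK vK]] := motion_inv mt.
have lv : l1 (v (u X)).
  have spA' : splits s a (v (t A)) l1 l2 by rewrite tK.
  by apply: (motion_side mv spB spA' mtX _ muX); rewrite tK.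
have eid := motion_id (motion_comp mv mu) spA _ lX lv.
apply/funext => Z; rewrite -{1}(vK (u Z)).
by rewrite -[v (u Z)]/((v \o u) Z) eid //= e tK.
Qed.

(* Knaster-Tarski: an increasing self-map of a complete order has a fixed
   point, so a motion cannot map a segment into a proper part of itself. *)
Lemma motion_noshrink t P Q : I t -> P <> Q -> Q <> a P ->
  s P (t Q) (t P) -> s P Q (t Q) -> t = id.
Proof.
move=> mt PQ QP hP hQ.
have hP' := btw_trans hQ hP.
have self X : s P Q X -> s P Q (t X).
  by move=> /(motion_btw mt) h; apply: btw_convex hP' hQ h.
have mono X Y : s P Y X -> s P Q Y -> s P (t Y) (t X).
  move=> hX hY; have /(motion_btw mt) hX' := hX.
  have hPY : s P (t Y) (t P).
    by have := btw_trans_r (btwC hP) (btwC (motion_btw mt hY)) => /btwC.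
  exact: btw_convex hPY (btw_r _ _) hX'.
(* The down-closure of the points that [t] does not move back towards [P]; its cut is the supremum
   in the fixed-point argument. *)
pose D := [set X | exists Y, [/\ s P Q Y, s P (t Y) Y & s P Y X]].
have [|X Y _ [Z [hZ hZ' h]] hX|M [hM below above]] :=
    seg_cut bs (D := D) (circle_connected circ QP).
- by exists P; split; apply: btw_l.
- by exists Z; split=> //; apply: btw_trans h hX.
have up Y : s P Q Y -> s P (t Y) Y -> s P M Y.
  move=> hY hY'; have [//|h] := btw_total hM hY.
  have [->|YM] := pselect (Y = M); first exact: btw_r.
  case: (above Y _ YM); first by apply: btw_trans_r hY h.
  by exists Y; split=> //; apply: btw_r.
have htM := self _ hM.
have h1 : s P (t M) M.
  have [//|h] := btw_total htM hM.
  have [e|n] := pselect (t M = M); first by rewrite e; apply: btw_r.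
  have [X [hX X1 X2]] := seg_dense n (btw_antipode QP htM hM).
  have [Y [hY hY' hXY]] : D X.
    by apply: below => //; apply: btw_convex h (btw_r _ _) hX.
  case: X1; apply: (@btw_anti P).
    apply: btw_trans (mono _ _ (up _ hY hY') hM) _.
    exact: btw_trans hY' hXY.
  exact: btwC (btw_trans_r (btwC h) (btwC hX)).
have e : t M = M.
  have h2 : s P M (t M) by apply: up => //; apply: mono.
  exact: btw_anti h2 h1.
have PaM : P <> a M by apply: btw_antipode QP hM (btw_l _ _).
have QaM : Q <> a M by apply: btw_antipode QP hM (btw_r _ _).
have hMtQ : s P (t Q) M by rewrite -e; apply: mono => //; apply: btw_r.
have hMtP : s P M (t P) by rewrite -e; apply: mono => //; apply: btw_l.
(* An end other than the fixed point [M] stays on its ray from [M], so [motion_fix] applies. *)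
have [PM|PM] := pselect (P = M).
  apply: (@motion_fix t M Q) => //; first by rewrite -PM; apply: nesym.
  by left; rewrite -PM.
apply: (@motion_fix t M P) => //; left; exact: btwC.
Qed.

(** * Midpoints *)

(** Intermediate value argument: [f] is an order-reversing involution of [s P Q], and [D] holds the
    points not moved towards [P]. *)
Lemma motion_swap_fixed f P Q : I f -> f P = Q -> f Q = P -> Q <> a P ->
  exists M, s P Q M /\ f M = M.
Proof.
move=> mf fP fQ QP.
have [e|PQ] := pselect (P = Q).
  by exists P; split; [apply: btw_l|rewrite fP].
have ff X : f (f X) = X.
  have : f \o f = id.
    apply: (@motion_fix _ P Q) => //; first exact: motion_comp.
    - by rewrite /= fP fQ.
    - exact: nesym.
    - by left; rewrite /= fQ fP; apply: btw_r.
  by move/(congr1 (fun g => g X)).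
have self X : s P Q X -> s P Q (f X).
  by move=> /(motion_btw mf); rewrite fP fQ; apply: btwC.
have anti X Y : s P Y X -> s P Q Y -> s P (f X) (f Y).
  move=> /(motion_btw mf) + /self hY; rewrite fP => h.
  exact: btwC (btw_trans_r (btwC hY) h).
pose D := [set X | s P Q X /\ s P (f X) X].
have [|X Y _ [hY hY'] hX|M [hM below above]] :=
    seg_cut bs (D := D) (circle_connected circ QP).
- by split; apply: btw_l.
- split; first exact: btw_trans hY hX.
  exact: btw_trans (anti _ _ hX hY) (btw_trans hY' hX).
have hfM := self _ hM.
have [e|fMM] := pselect (f M = M); first by exists M.
have [X [hX X1 X2]] := seg_dense (nesym fMM) (btw_antipode QP hM hfM).
have hX' := btw_convex hM hfM hX; have hfX := self _ hX'.
have fXM : f X <> M by move=> e; apply: X2; rewrite -e ff.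
(* If [f M] comes before [M], so do [X] and [f X]; both are in [D], which makes [X] a fixed
   point. *)
have [h|h] := btw_total hM hfM.
  have /below [|_] // : s P M (f X).
    by have := anti _ _ (btwC (btw_trans_r (btwC h) hX)) hX'; rewrite ff.
  rewrite ff => hfX'; exists X; split=> //.
  have [_ h'] := below X (btw_convex h (btw_r _ _) (btwC hX)) X1.
  exact: btw_anti hfX' h'.
have hXf := btw_convex h (btw_r _ _) hX.
have nD Y : s P Q Y -> s P Y M -> Y <> M -> ~ D Y.
  by move=> hY hMY; apply: above; apply: btw_trans_r hY hMY.
have hMX : s P X M := btwC (btw_trans_r (btwC h) (btwC hX)).
(* Otherwise [X] and [f X] come after [M], outside [D], yet the earlier of the two is in [D]. *)
case: (nD X) => //; split=> //.
have [//|h'] := btw_total hfX hX'.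
case: (nD (f X)) => //; last by split=> //; rewrite ff.
by have := anti _ _ hXf hfM; rewrite ff.
Qed.

(** [f \o f] maps [s P Q] into itself with its direction kept, so it is the identity by
    [motion_noshrink]. *)
Lemma motion_swap f P Q : I f -> P <> Q -> Q <> a P -> f P = Q ->
  s Q P (f Q) -> f Q = P.
Proof.
move=> mf PQ QP fP h.
have h1 : s Q (f Q) (f (f Q)) by have := motion_btw mf (btwC h); rewrite fP.
have := motion_noshrink (motion_comp mf mf) PQ QP; rewrite /= fP => e.
have : f \o f = id.
  apply: e; first exact: btwC (btw_trans_r h h1).
  exact: btwC (btw_trans h h1).
by move/(congr1 (fun g => g P)); rewrite /= fP.
Qed.

(** Let [f] carry the ray from [P] through [Q] to the ray from [Q] through [P]. Then [motion_swap]
    applies to [f] if [f Q] is between [Q] and [P], and to its inverse if [f Q] is beyond [P]. *)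
Lemma motion_midpoint P Q : Q <> a P ->
  exists f M, [/\ I f, f P = Q, f Q = P, f M = M & s P Q M].
Proof.
move=> QP; have [<-|PQ] := pselect (P = Q).
  exists id, P; split=> //; last exact: btw_l.
  exact: igroup_id (motions_group E).
have PQ' : P <> a Q by move=> e; apply: QP; rewrite e antipodeK.
have [l1 [l2 [spP lQ]]] := splits_ex (nesym PQ) QP.
have [m1 [m2 [spQ mP]]] := splits_ex PQ PQ'.
have [f [mf fP sub]] := motion_ex spP spQ.
have fQ : f Q = P.
  have [h|h] := splits_total spQ mP (sub _ lQ).
    exact: motion_swap mf PQ QP fP h.
  have [u [mu fK uK]] := motion_inv mf.
  have uQ : u Q = P by rewrite -fP fK.
  suff <- : u P = Q by rewrite uK.
  apply: (motion_swap mu (nesym PQ) PQ' uQ).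
  by have := motion_btw mu h; rewrite uQ fK.
have [M [hM eM]] := motion_swap_fixed mf fP fQ QP.
by exists f, M.
Qed.

(* [M] is the midpoint of one of the two half circles from [O] to [a O]. *)
Definition quarter (O M : E) := exists f, [/\ I f, f M = M & f O = a O].

Lemma quarter_neq O M : quarter O M -> M <> O /\ M <> a O.
Proof.
case=> f [mf fM fO]; split=> e.
  by apply: (@antipode_neq O); rewrite -fO -e.
by apply: (@antipode_neq O); rewrite -e -fM e motion_antipode// fO antipodeK.
Qed.

Lemma quarter_antipode O M : quarter O M -> quarter (a O) M.
Proof.
case=> f [mf fM fO]; exists f; split=> //.
by rewrite motion_antipode// fO.
Qed.

Lemma quarter_motion O M t : I t -> quarter O M -> quarter (t O) (t M).
Proof.
move=> mt [f [mf fM fO]]; have [u [mu tK uK]] := motion_inv mt.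
exists (t \o (f \o u)); split => /=.
- exact: motion_comp mt (motion_comp mf mu).
- by rewrite tK fM.
- by rewrite tK fO motion_antipode.
Qed.

(** The motion turning the half circle end for end is an involution. It swaps any [X] of [l1] with
    [f X] and so fixes a point between them. *)
Lemma quarter_ex O l1 l2 : splits s a O l1 l2 -> exists2 M, quarter O M & l1 M.
Proof.
move=> sp; have spa := splits_antipode sp.
have [f [mf fO sub]] := motion_ex sp spa.
have [X lX] := half_nonempty (splits_half sp).
have ffO : f (f O) = O by rewrite fO motion_antipode// fO antipodeK.
have ff := motion_id (motion_comp mf mf) sp ffO lX (sub _ (sub _ lX)).
have ffX : f (f X) = X := congr1 (fun g => g X) ff.
have [M [hM fM]] := motion_swap_fixed mf erefl ffX
  (half_antipode (splits_half sp) lX (sub _ lX)).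
by exists M; [exists f|apply: half_convex (splits_half sp) lX (sub _ lX) hM].
Qed.

(** The motions turning the half circle about [M] and [N] coincide; with two fixed points this
    motion would be the identity. *)
Lemma quarter_uniq O l1 l2 M N : splits s a O l1 l2 -> l1 M -> l1 N ->
  quarter O M -> quarter O N -> M = N.
Proof.
move=> sp lM lN [f [mf fM fO]] [g [mg gN gO]].
have spa := splits_antipode sp.
have spf : splits s a (f O) l1 l2 by rewrite fO.
have spg : splits s a (g O) l1 l2 by rewrite gO.
have lfN : l1 (f N) by apply: (motion_side mf sp spf lM _ lN); rewrite fM.
have e : f = g.
  apply: (motion_eq mf mg sp spf _ lN lfN); last by rewrite gN.
  by rewrite gO fO.
apply: contrapT => MN.
have : f = id.
  apply: (@motion_fix f M N) => //; first exact: nesym.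
  - exact: half_antipode (splits_half sp) lM lN.
  - by left; rewrite e gN; apply: btw_r.
by move=> eid; apply: (@antipode_neq O); rewrite -fO eid.
Qed.

Lemma quarter_congruent O M A B : quarter O M -> quarter A B ->
  exists t, [/\ I t, t A = O & t B = M].
Proof.
move=> qO qA; have [MO MaO] := quarter_neq qO; have [BA BaA] := quarter_neq qA.
have [l1 [l2 [spO lM]]] := splits_ex MO MaO.
have [m1 [m2 [spA mB]]] := splits_ex BA BaA.
have [t [mt tA sub]] := motion_ex spA spO.
exists t; split=> //; apply: (quarter_uniq spO (sub _ mB) lM _ qO).
by rewrite -tA; apply: quarter_motion.
Qed.

(** The motion [f] fixes [M] and exchanges [O] and [a O], which are on opposite sides of [M]; so it
    is the reflection at [M]. *)
Lemma quarter_right_angle O M : quarter O M -> right_angle M O.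
Proof.
move=> qO; have [MO MaO] := quarter_neq qO.
have OM : O <> M by apply: nesym.
have OaM : O <> a M by move=> e; apply: MaO; rewrite e antipodeK.
case: qO => f [mf fM fO].
have [l1 [l2 [sp lO]]] := splits_ex OM OaM.
have ff X : f (f X) = X.
  have : f \o f = id.
    apply: (motion_id (motion_comp mf mf) sp _ lO); first by rewrite /= !fM.
    by rewrite /= fO motion_antipode// fO antipodeK.
  by move/(congr1 (fun g => g X)).
have sp1 : splits s a (f M) l1 l2 by rewrite fM.
have sp2 : splits s a (f M) l2 l1 by apply: splitsC.
have laO := splits_swap sp lO.
have s12 X : l1 X -> l2 (f X).
  by move=> lX; apply: (motion_side mf sp sp2 lO _ lX); rewrite fO.
have s21 X : l2 X -> l1 (f X).
  move=> lX; apply: (motion_side mf (splitsC sp) sp1 laO _ lX).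
  by rewrite -fO ff.
exists f; split=> //; split=> //; exists l1, l2; split=> //.
- apply/seteqP; split=> X.
    by case=> Y [->|lY] <-; [left|right; apply: s12].
  case=> [->|lX]; first by exists M => //; left.
  by exists (f X) => //; right; apply: s21.
- apply/seteqP; split=> X.
    by case=> Y [->|lY] <-; [left|right; apply: s21].
  case=> [->|lX]; first by exists M => //; left.
  by exists (f X) => //; right; apply: s12.
Qed.

(* The reflection [i] at [A] commutes with the reflection [j] at [B], because
   [i B = a B]; so [i] fixes [j A], which can then only be [a A]. *)
Lemma right_angle_quarter A B : right_angle A B -> quarter A B.
Proof.
case=> i [[mi [l1 [l2 [sp e1 e2]]]] iB].
have iA : i A = A by apply: motion_apex mi sp (splitsC sp) e1.
have side X : l1 X -> l2 (i X).
  move=> lX; have : (i @` ([set A] `|` l1)) (i X) by exists X => //; right.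
  rewrite e1 => -[h|//]; have [+ _] := half_neq (splits_half sp) lX.
  by case; apply: (motion_inj mi); rewrite iA.
have side' X : l2 X -> l1 (i X).
  move=> lX; have : (i @` ([set A] `|` l2)) (i X) by exists X => //; right.
  rewrite e2 => -[h|//].
  have [+ _] := half_neq (splits_half (splitsC sp)) lX.
  by case; apply: (motion_inj mi); rewrite iA.
have BA : A <> B by move=> e; apply: (@antipode_neq B); rewrite -iB -e iA.
have BaA : A <> a B.
  by move=> e; apply: BA; rewrite -iA e motion_antipode// iB antipodeK.
have [n1 [n2 [spB nA]]] := splits_ex BA BaA.
have naA := splits_swap spB nA.
have [j [mj jB sub]] := motion_ex spB (splitsC spB).
have spaB := splits_antipode spB.
have spiB : splits s a (i B) n1 n2 by rewrite iB.
have spjB : splits s a (j B) n1 n2 by rewrite jB.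
have j21 X : n2 X -> n1 (j X).
  move=> nX; apply: (motion_side mj (splitsC spB) spjB naA _ nX).
  rewrite motion_antipode//.
  exact: splits_swap (splitsC spB) (sub _ nA).
have i1 X : n1 X -> n1 (i X).
  by move=> nX; apply: (motion_side mi spB spiB nA _ nX); rewrite iA.
have i2 X : n2 X -> n2 (i X).
  move=> nX; apply: (motion_side mi (splitsC spB) (splitsC spiB) naA _ nX).
  by rewrite motion_antipode// iA.
have [X lX] := half_nonempty (splits_half sp).
have ii : i \o i = id.
  apply: (motion_id (motion_comp mi mi) sp _ lX (side' _ (side _ lX))).
  by rewrite /= !iA.
have jj : j \o j = id.
  apply: (motion_id (motion_comp mj mj) spB _ nA (j21 _ (sub _ nA))).
  by rewrite /= !jB.
have ijij : (i \o j) \o (i \o j) = id.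
  have mij := motion_comp mi mj.
  apply: (motion_id (motion_comp mij mij) spB _ nA _) => /=.
    by rewrite jB iB motion_antipode// jB motion_antipode// iB antipodeK.
  by apply: i1; apply: j21; apply: i2; apply: sub.
have iK Y : i (i Y) = Y by move/(congr1 (fun g => g Y)): ii.
have jK Y : j (j Y) = Y by move/(congr1 (fun g => g Y)): jj.
have fixed : i (j A) = j A.
  have /(congr1 (fun g => g A)) /= h := ijij.
  by rewrite -[in RHS]iA -{2}h iK jK.
exists j; split=> //; apply: contrapT => n.
have jA : j A <> A.
  by move=> e; apply: (splits_disj spB nA); rewrite -e; apply: sub.
case: (splits_cover sp jA n) => h.
  by apply: (splits_disj sp h); rewrite -fixed; apply: side.
by apply: (splits_disj (splitsC sp) h); rewrite -fixed; apply: side'.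
Qed.

End Motions.

(** * Existence of the measure *)

Section Packing.
Variable E : erlangen_circle.
Local Notation s := (@seg E).
Local Notation a := (@antipode E).
Local Notation I := (@motions E).
Local Notation circ := (circleP E).
Local Notation bs := (circle_btw circ).
Local Notation btwC := (btwC bs).
Local Notation btw_l := (btw_l bs).
Local Notation btw_r := (btw_r bs).
Local Notation btw_id := (btw_id bs).
Local Notation btw_case := (btw_case bs).
Local Notation btw_anti := (btw_anti bs).
Local Notation btw_trans := (btw_trans bs).
Local Notation btw_trans_r := (btw_trans_r bs).
Local Notation btw_convex := (btw_convex bs).
Local Notation antipode_out := (antipode_out circ).

(** The swapping motions are kept because they make units symmetric and the two halves of a unit
    congruent. *)
Definition bisecting (O : E) (d : nat -> E) := quarter O (d 0%N) /\
  forall n, exists f,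
    [/\ I f, f O = d n, f (d n) = O, f (d n.+1) = d n.+1 & s O (d n) (d n.+1)].

Lemma bisecting_out O d n : bisecting O d -> d n <> O /\ d n <> a O.
Proof.
case=> /quarter_neq q0 h; elim: n => [//|n [IH1 IH2]].
have [f [mf fO fd fd' hd]] := h n; split=> e.
  by apply: IH1; rewrite -fO -e fd'.
by apply: IH2; apply: antipode_out; rewrite -e.
Qed.

Lemma bisecting_ex O l1 l2 : splits s a O l1 l2 ->
  exists2 d, bisecting O d & l1 (d 0%N).
Proof.
move=> sp; have [M qM lM] := quarter_ex sp; have [MO MaO] := quarter_neq qM.
(* The value at [P = a O] is arbitrary; the iteration never reaches [a O]. *)
have /choice [mid midP] : forall P, exists C, P <> a O -> exists f,
    [/\ I f, f O = P, f P = O, f C = C & s O P C].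
  move=> P; have [e|n] := pselect (P = a O); first by exists O.
  by have [f [C h]] := motion_midpoint n; exists C => _; exists f.
pose d n := iter n mid M; exists d => //; split=> // n.
suff /midP : d n <> a O by [].
elim: n => [//|n IH]; have [f [_ _ _ _ h]] := midP _ IH.
by move=> e; apply: IH; apply: antipode_out; rewrite -e.
Qed.

Variables (O : E) (d : nat -> E).
Hypothesis bis : bisecting O d.

Definition is_unit n X Y := exists t, [/\ I t, t O = X & t (d n) = Y].

Lemma unit_sym n X Y : is_unit n X Y -> is_unit n Y X.
Proof.
case=> t [mt <- <-]; have [f [mf fO fd _ _]] := bis.2 n.
by exists (t \o f); split; [exact: motion_comp|rewrite /= fO|rewrite /= fd].
Qed.

Lemma unit_motion n X Y t : I t -> is_unit n X Y -> is_unit n (t X) (t Y).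
Proof.
move=> mt [u [mu <- <-]]; exists (t \o u); split=> //; exact: motion_comp.
Qed.

Lemma unit_congruent n X Y X' Y' : is_unit n X Y -> is_unit n X' Y' ->
  exists t, [/\ I t, t X = X' & t Y = Y'].
Proof.
case=> t [mt <- <-] [u [mu <- <-]]; have [v [mv tK vK]] := motion_inv mt.
by exists (u \o v); split; [exact: motion_comp|rewrite /= tK|rewrite /= tK].
Qed.

Lemma unit_neq n X Y : is_unit n X Y -> Y <> X /\ Y <> a X.
Proof.
case=> t [mt <- <-]; have [h1 h2] := bisecting_out n bis.
split; first by move=> /(motion_inj mt).
by rewrite -motion_antipode// => /(motion_inj mt).
Qed.

Lemma unit_split n X Y : is_unit n X Y ->
  exists Z, [/\ s X Y Z, is_unit n.+1 X Z & is_unit n.+1 Z Y].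
Proof.
case=> t [mt <- <-]; have [f [mf fO fd fd' hd]] := bis.2 n.
exists (t (d n.+1)); split.
- exact: motion_btw.
- by exists t.
- apply: unit_sym; exists (t \o f); split; first exact: motion_comp.
    by rewrite /= fO.
  by rewrite /= fd'.
Qed.

(* [k] units fit into [s A B]; they do not overlap, but gaps are allowed. *)
Fixpoint pack n k A B : Prop := if k is k'.+1 then
  exists X Y, [/\ s A B Y, s A Y X, is_unit n X Y & pack n k' Y B] else True.

Lemma pack_motion n k A B t : I t -> pack n k A B -> pack n k (t A) (t B).
Proof.
move=> mt; elim: k A => [//|k IH] A [X [Y [h1 h2 h3 h4]]].
exists (t X), (t Y); split; [exact: motion_btw|exact: motion_btw| |exact: IH].
exact: unit_motion.
Qed.

Lemma pack_left n k A B C : s A B C -> pack n k C B -> pack n k A B.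
Proof.
case: k => [//|k] hC [X [Y [h1 h2 h3 h4]]].
have hY := btw_convex hC (btw_r _ _) h1.
exists X, Y; split=> //; apply: btw_convex (btw_r _ _) h2.
exact: btwC (btw_trans_r (btwC hC) (btwC h1)).
Qed.

Lemma pack_right n k A B C : s A B C -> pack n k A C -> pack n k A B.
Proof.
elim: k A => [//|k IH] A hC [X [Y [h1 h2 h3 h4]]].
exists X, Y; split=> //; first exact: btw_trans hC h1.
by apply: IH h4; apply: btw_trans_r hC h1.
Qed.

Lemma pack_cat n j k A B C : s A B C -> pack n j A C -> pack n k C B ->
  pack n (j + k) A B.
Proof.
elim: j A => [|j IH] A hC; first by move=> _; apply: pack_left.
move=> [X [Y [h1 h2 h3 h4]]] hk; exists X, Y; split=> //.
  exact: btw_trans hC h1.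
by apply: IH h4 hk; apply: btw_trans_r hC h1.
Qed.

Lemma pack_cut n k A B C : s A B C -> pack n k A B -> exists j1 j2,
  [/\ (k <= j1 + j2 + 1)%N, pack n j1 A C & pack n j2 C B].
Proof.
elim: k A => [|k IH] A hC; first by exists 0%N, 0%N.
move=> [X [Y [h1 h2 h3 h4]]]; have [h|h] := btw_case h1 hC.
  (* [C] comes before the end of the first unit, which may be cut and is given up. *)
  exists 0%N, k; split=> //; first by rewrite add0n addn1.
  exact: pack_left (btw_trans_r h1 h) h4.
have [j1 [j2 [hk p1 p2]]] := IH Y h h4.
exists j1.+1, j2; split=> //.
exists X, Y; split=> //.
exact: btwC (btw_trans_r (btwC h1) (btwC h)).
Qed.

Lemma pack_refine n m k A B : pack n k A B -> pack (n + m) (k * 2 ^ m) A B.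
Proof.
elim: m k => [|m IH] k; first by rewrite addn0 muln1.
move=> /IH; rewrite addnS expnS mulnCA; move: (k * _)%N (n + m)%N => {n m IH}k n.
rewrite mul2n; elim: k A => [//|k IH] A [X [Y [h1 h2 h3 /IH h4]]].
have [Z [hZ u1 u2]] := unit_split h3; rewrite doubleS.
have hZ' := btw_convex h2 (btw_r _ _) hZ.
have hXZ : s A Z X.
  exact: btwC (btw_trans_r (btwC h2) (btwC hZ)).
exists X, Z; split=> //; first exact: btw_trans h1 hZ'.
exists Z, Y; split=> //; first exact: btw_trans_r h1 hZ'.
exact: btw_l.
Qed.

(** With two units inside, the motion taking [s A B] to the second is the identity by
    [motion_noshrink], which leaves no room for the first. *)
Lemma pack_unit n k A B : is_unit n A B -> pack n k A B -> (k <= 1)%N.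
Proof.
move=> uAB; case: k => [|[|k]] //.
move=> [X1 [Y1 [hY1 hX1 u1 [X2 [Y2 [hY2 hX2 u2 _]]]]]].
have [g [mg gA gB]] := unit_congruent uAB u2.
have [BA BaA] := unit_neq uAB.
have hY1' : s A Y2 Y1 := btwC (btw_trans_r (btwC hY1) (btwC hY2)).
have gid : g = id.
  apply: (motion_noshrink mg (nesym BA) BaA); rewrite ?gA ?gB.
    exact: btw_convex hY1' (btw_r _ _) hX2.
  exact: btw_convex hY1 (btw_r _ _) hY2.
have eA : A = X2 by rewrite -gA gid.
have eY : Y1 = A.
  by apply: (@btw_anti Y2); [exact: btwC|rewrite {1}eA; exact: btwC].
have [n1 _] := unit_neq u1; case: n1.
by rewrite eY in hX1 *; rewrite (btw_id hX1).
Qed.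

Lemma pack_unit_lt n m k A B : is_unit n A B -> pack (n + m) k A B ->
  (k < 2 ^ m.+1)%N.
Proof.
elim: m n k A B => [|m IH] n k A B u.
  by rewrite addn0 expn1 ltnS; apply: pack_unit.
have [Z [hZ u1 u2]] := unit_split u; rewrite addnS -addSn.
move=> /(pack_cut hZ) [j1 [j2 [hk /(IH _ _ _ _ u1) h1 /(IH _ _ _ _ u2) h2]]].
(* The strict bounds absorb the unit lost at the cut. *)
by rewrite expnS mul2n -addnn; lia.
Qed.

(** This bounds [ratios]. A motion brings [A] to [O] and [B] to the half circle of [d 0], which
    consists of two quarters holding fewer than [2 ^ n.+1] units each. *)
Lemma pack_lt n k A B : B <> a A -> pack n k A B -> (k < 4 * 2 ^ n)%N.
Proof.
move=> BaA pk; have q := bis.1.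
have bound A' B' j : is_unit 0 A' B' -> pack n j A' B' -> (j < 2 ^ n.+1)%N.
  by move=> u p; apply: (pack_unit_lt (n := 0) (m := n)) u _; rewrite add0n.
have [e|AB] := pselect (B = A).
  subst B; case: k pk => [_|k [X [Y [/btw_id -> /btw_id -> /unit_neq []//]]]].
  by rewrite muln_gt0 expn_gt0.
have [l1 [l2 [spA lB]]] := splits_ex circ AB BaA.
have [dO daO] := bisecting_out 0%N bis.
have [m1 [m2 [spO md]]] := splits_ex circ dO daO.
have [t [mt tA sub]] := motion_ex spA spO.
have mB := sub _ lB; have := pack_motion mt pk; rewrite tA => {}pk.
have uO : is_unit 0 O (d 0%N).
  by exists id; split=> //; exact: igroup_id (motions_group E).
have ua : is_unit 0 (d 0%N) (a O).
  have [f [mf fd fO]] := q; apply: unit_sym; exists f; split=> //.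
rewrite -[4%N]/(2 ^ 2)%N -expnD.
have [h|h] := splits_total circ spO mB md.
  have [j1 [j2 [hk p1 p2]]] := pack_cut h pk.
  have h1 := bound _ _ _ uO p1.
  have h2 := bound _ _ _ ua (pack_right (splits_opposite circ spO md mB h) p2).
  by rewrite expnD; rewrite expnS in h1 h2; lia.
have h1 := bound _ _ _ uO (pack_right h pk).
by rewrite expnD; rewrite expnS in h1; lia.
Qed.

End Packing.

Lemma ler_addexp2V (R : realType) (x y c : R) : 0 <= c ->
  (forall m : nat, x <= y + c / 2 ^+ m) -> x <= y.
Proof.
move=> c0 h; apply/ler_addgt0Pr => e e0.
have /upper_nthrootP := leqnn (Num.bound (c / e)).
set m := Num.bound _ => hm; apply: le_trans (h m) _.
rewrite lerD2l ler_pdivrMr ?exprn_gt0// mulrC -ler_pdivrMr//.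
exact: ltW.
Qed.

Section MeasureExistence.
Variables (R : realType) (E : erlangen_circle) (O : E) (d : nat -> E).
Hypothesis bis : bisecting O d.
Local Notation s := (@seg E).
Local Notation a := (@antipode E).
Local Notation I := (@motions E).
Local Notation circ := (circleP E).
Local Notation bs := (circle_btw circ).
Local Notation btw_l := (btw_l bs).
Local Notation btw_r := (btw_r bs).
Local Notation antipodeK := (antipodeK circ).
Local Notation btw_antipode := (btw_antipode circ).
Local Notation pack := (pack O d).

Definition ratios (A B : E) : set R :=
  [set x | exists n k, pack n k A B /\ x = k%:R / 2 ^+ n].

Definition len A B := sup (ratios A B).

Lemma ratios_nonempty A B : ratios A B !=set0.
Proof. by exists 0, 0%N, 0%N; split=> //; rewrite mul0r. Qed.

Lemma len_ge A B n k : B <> a A -> pack n k A B -> k%:R / 2 ^+ n <= len A B.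
Proof.
move=> BA pk; apply: ub_le_sup; last by exists n, k.
exists 4 => _ [m [j [/(pack_lt bis BA) h ->]]].
by rewrite ler_pdivrMr ?exprn_gt0// -natrX -natrM ler_nat ltnW.
Qed.

Lemma len_le A B x : (forall n k, pack n k A B -> k%:R / 2 ^+ n <= x) ->
  len A B <= x.
Proof.
move=> h; apply: ge_sup; first exact: ratios_nonempty.
by move=> _ [n [k [/h ? ->]]].
Qed.

Lemma ratio_refine n m k :
  (k * 2 ^ m)%:R / 2 ^+ (n + m) = k%:R / 2 ^+ n :> R.
Proof.
by rewrite natrM natrX exprD -mulf_div divff ?mulr1// expf_neq0 ?pnatr_eq0.
Qed.

Lemma len_add A B C : B <> a A -> s A B C -> len A B = len A C + len C B.
Proof.
move=> BA hC; have CA := btw_antipode BA (btw_l A B) hC.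
have BC := btw_antipode BA hC (btw_r A B).
apply/eqP; rewrite eq_le; apply/andP; split.
  (* After refining [m] times the unit lost at [C] has size at most [2^-m], and [m] is arbitrary. *)
  apply: len_le => n k pk; apply: (@ler_addexp2V _ _ _ 1) => // m.
  have [j1 [j2 [hk p1 p2]]] := pack_cut hC (pack_refine bis m pk).
  have h1 := len_ge CA p1; have h2 := len_ge BC p2.
  rewrite -(ratio_refine n m).
  have h3 : (k * 2 ^ m)%:R / 2 ^+ (n + m) <=
      j1%:R / 2 ^+ (n + m) + j2%:R / 2 ^+ (n + m) + 1 / 2 ^+ (n + m) :> R.
    rewrite addn1 in hk; rewrite -!mulrDl ler_pM2r ?invr_gt0 ?exprn_gt0// -natrD.
    by rewrite natr1 ler_nat.
  have h4 : 1 / 2 ^+ (n + m) <= 1 / 2 ^+ m :> R.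
    rewrite !div1r lef_pV2 ?posrE ?exprn_gt0// exprD ler_peMl ?exprn_ge0//.
    by rewrite exprn_ege1// ler1n.
  by lra.
rewrite -lerBrDr; apply: len_le => n k pk.
rewrite lerBrDr addrC -lerBrDr; apply: len_le => m j pj.
(* Both packings are refined to level [n + m] and concatenated. *)
rewrite lerBrDr -(ratio_refine n m k) -(ratio_refine m n j) [(m + n)%N]addnC.
rewrite -mulrDl -natrD addnC.
apply: len_ge BA _; apply: pack_cat hC _ _; first exact: pack_refine.
by rewrite addnC; exact: pack_refine.
Qed.

Lemma len_motion A B t : I t -> len (t A) (t B) = len A B.
Proof.
move=> mt; have [u [mu tK uK]] := motion_inv mt.
congr sup; apply/seteqP; split=> _ [n [k [pk ->]]]; exists n, k; split=> //.
  by have := pack_motion mu pk; rewrite !tK.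
exact: pack_motion.
Qed.

Lemma len_sym A B : B <> a A -> len A B = len B A.
Proof.
move=> BA; have [f [M [mf fA fB _ _]]] := motion_midpoint BA.
by rewrite -(len_motion A B mf) fA fB.
Qed.

Lemma len_gt0 : 0 < len O (d 0%N).
Proof.
have [_ dO] := bisecting_out 0%N bis.
apply: lt_le_trans (len_ge (n := 0%N) (k := 1%N) dO _).
  by rewrite expr0 divr1.
exists O, (d 0%N); split => //; [exact: btw_r|exact: btw_l|].
by exists id; split=> //; exact: igroup_id (motions_group E).
Qed.

(** No unit fits between antipodal ends, so their measure is set by hand. The quotient gives right
    angles measure 1 without computing [len O (d 0)]. *)
Definition mu A B : R :=
  if `[< B = a A >] then 2 else len A B / len O (d 0%N).

Lemma mu_motion A B t : I t -> mu (t A) (t B) = mu A B.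
Proof.
move=> mt; rewrite /mu len_motion// -motion_antipode//.
suff -> : `[< t B = t (a A) >] = `[< B = a A >] by [].
by apply/asbool_equiv_eq; split=> [/(motion_inj mt)|->].
Qed.

Lemma mu_sym A B : mu A B = mu B A.
Proof.
rewrite /mu; case: asboolP => [->|BA]; first by rewrite antipodeK asboolT.
by case: asboolP => [e|_]; [case: BA; rewrite e antipodeK|rewrite len_sym].
Qed.

Lemma mu_is_measure : is_measure mu.
Proof.
have l0 := len_gt0; split.
- move=> A B; rewrite /mu; case: asboolP => // BA.
  apply: divr_ge0; last exact: ltW.
  by apply: le_trans (len_ge (n := 0%N) (k := 0%N) BA _) => //; rewrite mul0r.
- move=> A B C D [t [mt]]; have [_ ->] := igroup_iso (motions_group E) mt.
  move=> /(seg_inj bs) [[<- <-]|[<- <-]]; first by rewrite mu_motion.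
  by rewrite mu_sym mu_motion.
- have mu0 A : mu A A = 0.
    have nA : A <> a A by move=> /esym; exact: (antipode_neq circ).
    rewrite /mu; case: asboolP => // _.
    have h := len_add nA (btw_l A A).
    by rewrite (_ : len A A = 0) ?mul0r//; lra.
  move=> A B C hC; have [BA|BA] := pselect (B = a A).
    move: hC; rewrite BA => /(seg_antipode circ) [->|->]; rewrite mu0; lra.
  have CA := btw_antipode BA (btw_l A B) hC.
  have BC := btw_antipode BA hC (btw_r A B).
  by rewrite /mu !asboolF// (len_add BA hC) mulrDl.
- move=> A B /right_angle_quarter q.
  have [t [mt <- <-]] := quarter_congruent q bis.1.
  have [_ dO] := bisecting_out 0%N bis.
  by rewrite mu_motion// /mu asboolF// divff// gt_eqF.
- by move=> A; rewrite /mu asboolT.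
Qed.

End MeasureExistence.

(** * Uniqueness of the measure and the isometry *)

Section MeasureTheory.
Variables (R : realType) (E : erlangen_circle).
Local Notation s := (@seg E).
Local Notation a := (@antipode E).
Local Notation I := (@motions E).
Local Notation circ := (circleP E).
Local Notation bs := (circle_btw circ).
Local Notation btwC := (btwC bs).
Local Notation btw_l := (btw_l bs).
Local Notation btw_r := (btw_r bs).
Local Notation btw_trans := (btw_trans bs).
Local Notation antipodeK := (antipodeK circ).
Local Notation antipode_neq := (antipode_neq circ).
Local Notation antipode_out := (antipode_out circ).
Local Notation btw_antipode := (btw_antipode circ).
Local Notation splits_ray := (splits_ray circ).
Local Notation splits_total := (splits_total circ).
Local Notation splits_opposite := (splits_opposite circ).
Local Notation splits_antipode := (splits_antipode circ).

(** * The measure as a coordinate *)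

Section OneMeasure.
Variable mu : E -> E -> R.
Hypothesis hm : is_measure mu.

Lemma measure_motion A B t : I t -> mu (t A) (t B) = mu A B.
Proof.
move=> mt; symmetry; apply: (measure_congruent hm); exists t; split=> //.
by have [_] := igroup_iso (motions_group E) mt; apply.
Qed.

Lemma measure_sym A B : mu A B = mu B A.
Proof.
apply: (measure_congruent hm); exists id; split.
  exact: igroup_id (motions_group E).
by rewrite image_id (seg_sym bs).
Qed.

Lemma measure_id A : mu A A = 0.
Proof. by have := measure_additive hm (btw_l A A); lra. Qed.

Lemma measure_midpoint f P Q M : I f -> f P = Q -> f M = M -> s P Q M ->
  mu P M = mu P Q / 2 /\ mu M Q = mu P Q / 2.
Proof.
move=> mf fP fM /(measure_additive hm) ->.
have -> : mu M Q = mu P M by rewrite measure_sym -fP -{1}fM measure_motion.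
by split; lra.
Qed.

Lemma measure_quarter O M : quarter O M -> mu O M = 1.
Proof.
by move=> /quarter_right_angle /(measure_right_angle hm); rewrite measure_sym.
Qed.

(** Interior points of the half circle are not on [s O (a O)], so additivity is applied through the
    quarter point [M], at distance 1 from both ends. *)
Lemma measure_supplement O X : mu O X + mu X (a O) = 2.
Proof.
have h2 := measure_antipode hm.
have [->|XO] := pselect (X = O); first by rewrite measure_id h2 add0r.
have [->|XaO] := pselect (X = a O); first by rewrite measure_id h2 addr0.
have [l1 [l2 [sp lX]]] := splits_ex circ XO XaO.
have [M qM lM] := quarter_ex sp.
have h1 := measure_quarter qM.
have h1' := measure_quarter (quarter_antipode qM).
rewrite measure_sym in h1'.
have [h|h] := splits_total sp lX lM.
  have := measure_additive hm h.
  have := measure_additive hm (splits_opposite sp lM lX h); lra.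
have := measure_additive hm h.
have := measure_additive hm (splits_opposite sp lX lM h); lra.
Qed.

Lemma measure_le2 A B : mu A B <= 2.
Proof.
have := measure_supplement A B; have := measure_ge0 hm B (a A); lra.
Qed.

Lemma measure_small P Q e : P <> Q -> Q <> a P -> 0 < e ->
  exists X, [/\ s P Q X, X <> P & mu P X < e].
Proof.
move=> PQ QP e0.
have H n : exists X, [/\ s P Q X, X <> P & mu P X = mu P Q / 2 ^+ n].
  elim: n => [|n [X [hX XP eX]]].
    by exists Q; split; [exact: btw_r|exact: nesym|rewrite expr0 divr1].
  have XaP : X <> a P.
    by move=> e1; apply: QP; apply: antipode_out; rewrite -e1.
  have [f [Y [mf fP fX fY hY]]] := motion_midpoint XaP.
  exists Y; split; first exact: btw_trans hX hY.
    by move=> e1; apply: XP; rewrite -fP -e1.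
  have [-> _] := measure_midpoint mf fP fY hY.
  by rewrite eX exprSr invfM mulrA.
have /upper_nthrootP := leqnn (Num.bound (mu P Q / e)).
set n := Num.bound _ => hn; have [X [hX XP eX]] := H n.
exists X; split=> //; rewrite eX ltr_pdivrMr ?exprn_gt0// mulrC.
by rewrite -ltr_pdivrMr.
Qed.

(** Intermediate value argument: if the cut [m] at level [t] missed [t], a point close enough to [m]
    given by [measure_small] would be on the wrong side. *)
Lemma measure_attained_quarter O M t : quarter O M -> 0 <= t <= 1 ->
  exists X, s O M X /\ mu O X = t.
Proof.
move=> q /andP[t0 t1]; have [MO MaO] := quarter_neq q.
have [|X Y _ hY hX|m [hm1 below above]] :=
    seg_cut bs (D := [set X | mu O X <= t]) (circle_connected circ MaO).
- by rewrite /= measure_id.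
- rewrite /= in hY *; apply: le_trans hY.
  by rewrite (measure_additive hm hX) lerDl measure_ge0.
have OaM : O <> a M by move=> e; apply: MaO; rewrite e antipodeK.
exists m; split=> //; apply/eqP; rewrite eq_le; apply/andP; split.
  rewrite leNgt; apply/negP => lt.
  have mO : m <> O by move=> e; move: lt; rewrite e measure_id; lra.
  have Om := btw_antipode MaO hm1 (btw_l _ _).
  have [|X [hX Xm]] := measure_small mO Om (e := mu O m - t); first by lra.
  have := below X (btwC hX) Xm.
  by have := measure_additive hm (btwC hX); rewrite /= (measure_sym X m); lra.
rewrite leNgt; apply/negP => lt.
have mM : m <> M by move=> e; move: lt; rewrite e (measure_quarter q); lra.
have Mm := btw_antipode MaO hm1 (btw_r _ _).
have [|X [hX Xm]] := measure_small mM Mm (e := t - mu O m); first by lra.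
move=> hlt; apply: (above X hX Xm) => /=.
have := measure_additive hm (btw_trans_r bs (btwC hm1) (btwC hX)).
by rewrite measure_sym (measure_sym X m) (measure_sym m O); lra.
Qed.

Definition closed_half O (l : set E) X := [\/ X = O, X = a O | l X].

Lemma measure_attained O l1 l2 t : splits s a O l1 l2 -> 0 <= t <= 2 ->
  exists X, closed_half O l1 X /\ mu O X = t.
Proof.
move=> sp /andP[t0 t2]; have [M q lM] := quarter_ex sp.
have [t1|t1] := leP t 1.
  have [|X [hX <-]] := measure_attained_quarter q (t := t); first by rewrite t0.
  exists X; split=> //; have [->|XO] := pselect (X = O); first exact: Or31.
  by apply: Or33; apply: splits_ray sp lM hX XO.
(* Past the quarter point, distances are taken from [a O]. *)
have [|X [hX eX]] := measure_attained_quarter (quarter_antipode q) (t := 2 - t).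
  by apply/andP; split; lra.
exists X; split; last first.
  by have := measure_supplement O X; rewrite (measure_sym X) eX; lra.
have [->|XO] := pselect (X = a O); first exact: Or32.
by apply: Or33; apply: splits_ray (splits_antipode sp) lM hX XO.
Qed.

Lemma measure_closed_half O l1 l2 X Y : splits s a O l1 l2 ->
  closed_half O l1 X -> closed_half O l1 Y -> mu X Y = `|mu O X - mu O Y|.
Proof.
move=> sp.
have key X' Y' : s O Y' X' -> mu X' Y' = `|mu O X' - mu O Y'|.
  move=> /(measure_additive hm) ->; rewrite opprD addrA subrr add0r normrN.
  by rewrite ger0_norm// measure_ge0.
have keyC X' Y' : s O X' Y' -> mu X' Y' = `|mu O X' - mu O Y'|.
  by rewrite measure_sym distrC; exact: key.
have keyO Y' : mu O Y' = `|mu O O - mu O Y'| by apply: key; apply: btw_l.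
have keya Y' : mu (a O) Y' = `|mu O (a O) - mu O Y'|.
  rewrite (measure_antipode hm) ger0_norm ?subr_ge0 ?measure_le2//.
  by have := measure_supplement O Y'; rewrite (measure_sym Y'); lra.
case=> [->|->|lX] //; case=> [->|->|lY].
- by rewrite measure_sym distrC.
- by rewrite measure_sym distrC.
- by case: (splits_total sp lX lY) => h; [apply: keyC|apply: key].
Qed.

(** By [splits_cross] the segment runs through [O] or [a O]; it is the shorter of two arcs with
    total length 4. *)
Lemma measure_closed_halves O l1 l2 X Y : splits s a O l1 l2 ->
  closed_half O l1 X -> closed_half O l2 Y ->
  mu X Y = Num.min (mu O X + mu O Y) (4 - (mu O X + mu O Y)).
Proof.
move=> sp.
have keyO Y' : mu O Y' = Num.min (mu O O + mu O Y') (4 - (mu O O + mu O Y')).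
  rewrite measure_id add0r min_l//; have := measure_le2 O Y'; lra.
have keya Y' : mu (a O) Y' =
    Num.min (mu O (a O) + mu O Y') (4 - (mu O (a O) + mu O Y')).
  have := measure_supplement O Y'; rewrite (measure_antipode hm) (measure_sym Y').
  by have := measure_ge0 hm O Y' => ? ?; rewrite min_r; lra.
case=> [->|->|lX] //; case=> [->|->|lY].
- by rewrite measure_sym [mu O X + _]addrC.
- by rewrite measure_sym [mu O X + _]addrC.
have suppX := measure_supplement O X; have suppY := measure_supplement O Y.
have le2 := measure_le2 X Y.
have [e|YX] := pselect (Y = a X).
  have := measure_supplement X O; rewrite e (measure_antipode hm) (measure_sym X).
  by move=> ->; rewrite min_l//; lra.
case: (splits_cross circ sp lX lY YX) => /(measure_additive hm) h.
  by rewrite (measure_sym X O) in h; rewrite min_l; lra.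
by rewrite (measure_sym (a O) Y) in h; rewrite min_r; lra.
Qed.

End OneMeasure.

(** Both measures halve at midpoints, so each bisection around [X] halves the possible
    discrepancy. *)
Lemma measure_close (mu mu' : E -> E -> R) P Q X r n :
  is_measure mu -> is_measure mu' -> Q <> a P -> mu P Q = r -> mu' P Q = r ->
  s P Q X -> `|mu P X - mu' P X| <= r / 2 ^+ n.
Proof.
move=> hm hm'; elim: n P Q r => [|n IH] P Q r QP e e' hX.
  rewrite expr0 divr1.
  have := measure_additive hm hX; have := measure_additive hm' hX.
  have := measure_ge0 hm P X; have := measure_ge0 hm X Q.
  have := measure_ge0 hm' P X; have := measure_ge0 hm' X Q.
  by move=> *; rewrite ler_norml; apply/andP; split; lra.
have [f [M [mf fP fQ fM hM]]] := motion_midpoint QP.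
have [m1 m2] := measure_midpoint hm mf fP fM hM.
have [m1' m2'] := measure_midpoint hm' mf fP fM hM.
rewrite exprS invfM mulrA.
have [h|h] := btw_case bs hM hX.
  apply: IH h; [|by rewrite m1 e|by rewrite m1' e'].
  exact: btw_antipode QP (btw_l _ _) hM.
have := measure_additive hm (btwC (btw_trans_r bs (btwC hM) (btwC h))).
have := measure_additive hm' (btwC (btw_trans_r bs (btwC hM) (btwC h))).
move=> -> ->; rewrite m1 m1' e e' opprD addrACA subrr add0r.
apply: IH h; [|by rewrite m2 e|by rewrite m2' e'].
exact: btw_antipode QP hM (btw_r _ _).
Qed.

Lemma measure_uniq (mu mu' : E -> E -> R) :
  is_measure mu -> is_measure mu' -> mu = mu'.
Proof.
move=> hm hm'; apply/funext => A; apply/funext => B.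
have agree O M X : quarter O M -> s O M X -> mu O X = mu' O X.
  move=> q hX; have [_ MaO] := quarter_neq q.
  have m1 := measure_quarter hm q; have m1' := measure_quarter hm' q.
  have h n := measure_close n hm hm' MaO m1 m1' hX.
  apply/eqP; rewrite -subr_eq0 -normr_le0; apply: (@ler_addexp2V _ _ _ 1) => // n.
  by rewrite add0r.
have [->|BA] := pselect (B = A); first by rewrite !measure_id.
have [->|BaA] := pselect (B = a A).
  by rewrite (measure_antipode hm) (measure_antipode hm').
have [l1 [l2 [sp lB]]] := splits_ex circ BA BaA.
have [M q lM] := quarter_ex sp.
have [h|h] := splits_total sp lM lB; first exact: agree q h.
have := agree _ _ _ (quarter_antipode q) (btwC (splits_opposite sp lM lB h)).
have := measure_supplement hm A B; have := measure_supplement hm' A B.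
by rewrite !(measure_sym hm B) !(measure_sym hm' B); lra.
Qed.

Lemma measure_exists (O : E) :
  exists mu : E -> E -> R, unique (@is_measure E R) mu.
Proof.
have [l1 [l2 sp]] := circle_split circ O.
have [d bis _] := bisecting_ex sp.
have hm := mu_is_measure R bis.
by exists (mu R O d); split=> // mu'; exact: measure_uniq.
Qed.

End MeasureTheory.

Theorem theorem16p3 (R : realType) (E1 E2 : erlangen_circle)
    (A : E1) (B : E2) :
  exists f : E1 -> E2, is_isometry R f /\ f A = B.
Proof.
have [mu1 u1] := measure_exists R A; have [mu2 u2] := measure_exists R B.
have h1 := u1.1; have h2 := u2.1.
have [l1 [l2 spA]] := circle_split (circleP E1) A.
have [m1 [m2 spB]] := circle_split (circleP E2) B.
have range X : 0 <= mu1 A X <= 2 by rewrite measure_ge0// measure_le2.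
(* [f] keeps the coordinate and the half circle. [A] and its antipode belong to both closed halves,
   so their images must too. *)
have /choice [f fP] : forall X, exists Y, [/\ mu2 B Y = mu1 A X,
    closed_half A l1 X -> closed_half B m1 Y,
    closed_half A l2 X -> closed_half B m2 Y & X = A -> Y = B].
  move=> X; have [->|XA] := pselect (X = A).
    by exists B; rewrite !measure_id//; split=> // _; apply: Or31.
  have [->|XaA] := pselect (X = antipode A).
    exists (antipode B); rewrite (measure_antipode h1) (measure_antipode h2).
    split=> //; try by move=> _; apply: Or32.
    by move=> /(antipode_neq (circleP E1)).
  case: (splits_cover spA XA XaA) => lX.
    have [Y [hY eY]] := measure_attained h2 spB (range X).
    by exists Y; split=> // -[//|//|] /(splits_disj spA lX).
  have [Y [hY eY]] := measure_attained h2 (splitsC spB) (range X).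
  by exists Y; split=> // -[//|//|] /(splits_disj (splitsC spA) lX).
exists f; split; last by have [_ _ _ ->] := fP A.
exists mu1, mu2; split=> // X Y.
have halves Z : closed_half A l1 Z \/ closed_half A l2 Z.
  have [->|ZA] := pselect (Z = A); first by left; apply: Or31.
  have [->|ZaA] := pselect (Z = antipode A); first by left; apply: Or32.
  by case: (splits_cover spA ZA ZaA) => h; [left|right]; apply: Or33.
(* Distances are functions of coordinates: the absolute difference on one half, the shorter arc
   across two. *)
have [eX fX1 fX2 _] := fP X; have [eY fY1 fY2 _] := fP Y.
case: (halves X) => hX; case: (halves Y) => hY.
- rewrite (measure_closed_half h1 spA hX hY).
  by rewrite (measure_closed_half h2 spB (fX1 hX) (fY1 hY)) eX eY.
- rewrite (measure_closed_halves h1 spA hX hY).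
  by rewrite (measure_closed_halves h2 spB (fX1 hX) (fY2 hY)) eX eY.
- rewrite (measure_closed_halves h1 (splitsC spA) hX hY).
  by rewrite (measure_closed_halves h2 (splitsC spB) (fX2 hX) (fY1 hY)) eX eY.
- rewrite (measure_closed_half h1 (splitsC spA) hX hY).
  by rewrite (measure_closed_half h2 (splitsC spB) (fX2 hX) (fY2 hY)) eX eY.
Qed.
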